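(* Let $(w,\theta)$ be a pair of class $(BT_0)$ such that $w(x,y)=2\,\mathrm{arctanh}(F(x)G(y))$ for some non-constant functions $F,G$, and set $b(x)=\dfrac{F'(x)}{2F(x)}$ and $X(x)=\int_0^x\cosh w(t,0)\,dt$. Let $R_0=R(0,0)\in\mathbb{R}$, $S_0=S(0,0)\in\mathbb{R}\setminus\{0\}$. Let $\Omega$ be an open simply connected subset of the domain of $(w,\theta)$, containing the origin, on which the expressions $$S(x,y)=S_0\,\frac{e^{2X(x)}\bigl(\sin\theta(x,y)+b(x)\bigr)}{1+b(x)},\qquad R(x,y)=R_0+S_0\,\frac{e^{2X(x)}\cos\theta(x,y)}{1+b(x)}$$ make sense. Then $u=R+iS$ is, on $\Omega$, the harmonic map to the hyperbolic plane that corresponds to $w$.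
   Context: Points of $\mathbb{C}$ are written $z=x+iy$ and identified with $(x,y)$; $\partial_z=\frac12(\partial_x-i\partial_y)$, $\partial_{\bar z}=\frac12(\partial_x+i\partial_y)$, $\Delta=\partial_{xx}^2+\partial_{yy}^2$. Class $(BT)$: a pair of real-valued $C^2$ functions $(w,\theta)$ on an open simply connected subset of $\mathbb{C}$ containing the origin is in the class $(BT)$ if it satisfies the Bäcklund transformation $$\partial_x w-\partial_y\theta=-2\sinh w\,\sin\theta,\qquad \partial_y w+\partial_x\theta=-2\cosh w\,\cos\theta .$$ Consequently $w$ solves the sinh-Gordon equation $\Delta w=2\sinh(2w)$ and $\theta$ solves the sine-Gordon equation $\Delta\theta=-2\sin(2\theta)$. Class $(BT_0)$: $(w,\theta)$ is in $(BT_0)$ if it is in $(BT)$ and moreover $\partial_y w(x,0)=0$ (for all $x$ with $(x,0)$ in the domain) and $\theta(0,0)=\frac{\pi}{2}$. ''Make sense'' means in particular that, for every $(x,y)\in\Omega$, $(t,0)$ lies in the domain of $w$ for all $t$ between $0$ and $x$, $F(x)\neq0$ and $1+b(x)\neq 0$. Target: the hyperbolic plane is the half-plane with coordinates $R+iS$ and metric $(dR^2+dS^2)/S^2$ of curvature $-1$ (the upper half-plane when $S>0$; for $S<0$ the lower half-plane with the same formula for the metric). Harmonic map corresponding to $w$: for a solution $w$ of $\Delta w=2\sinh(2w)$ on an open simply connected set $\Omega\ni 0$, a $C^2$ map $u=R+iS$ on $\Omega$ with $S$ nowhere zero is called the harmonic map (to the hyperbolic plane) that corresponds to $w$ if it satisfies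 the Beltrami equation $\partial_{\bar z}u/\partial_z u=e^{-2w}$ and it is harmonic for the metric $(dR^2+dS^2)/S^2$, i.e. $\partial^2_{z\bar z}u+\frac{i}{S}\,\partial_z u\,\partial_{\bar z}u=0$, with the domain coordinate normalized so that $\dfrac{\partial_z u\,\partial_z\bar u}{S^2}=1$. (Uniqueness is not part of the assertion.) *)

(* Defs.v *)
From Stdlib Require Import Reals.
From Coquelicot Require Import Coquelicot.
Open Scope R_scope.

(* Coquelicot's [C] is [R * R], so [(x, y) : C] is
   literally the point [x + i y]. *)

Definition unit_interval (t : R) : Prop := 0 <= t <= 1.

Definition unit_square (p : R * R) : Prop :=
  unit_interval (fst p) /\ unit_interval (snd p).

Definition path_in (U : C -> Prop) (g : R -> C) : Prop :=
  continuous_on unit_interval g /\ (forall t, unit_interval t -> U (g t)).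

Definition path_connected (U : C -> Prop) : Prop :=
  forall p q : C, U p -> U q ->
  exists g : R -> C, path_in U g /\ g 0 = p /\ g 1 = q.

(* In a homotopy [H (s, t)], [s] is the deformation parameter and [t] the
   parameter of the loop. *)
Definition null_homotopic (U : C -> Prop) (g : R -> C) : Prop :=
  exists H : R * R -> C,
    continuous_on unit_square H /\
    (forall p, unit_square p -> U (H p)) /\
    (forall t, unit_interval t -> H (0, t) = g t) /\
    (forall t, unit_interval t -> H (1, t) = g 0) /\
    (forall s, unit_interval s -> H (s, 0) = g 0 /\ H (s, 1) = g 0).

Definition simply_connected (U : C -> Prop) : Prop :=
  path_connected U /\
  (forall g : R -> C, path_in U g -> g 0 = g 1 -> null_homotopic U g).

Definition pointed_domain (U : C -> Prop) : Prop :=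
  open U /\ simply_connected U /\ U (0, 0).

(* [Derive] is total (junk where the derivative
   does not exist); existence is provided separately by [C1_on], [C2_on]. *)

Definition dx (f : C -> R) (z : C) : R := Derive (fun t => f (t, snd z)) (fst z).
Definition dy (f : C -> R) (z : C) : R := Derive (fun t => f (fst z, t)) (snd z).

Definition ex_dx (f : C -> R) (z : C) : Prop :=
  ex_derive (fun t => f (t, snd z)) (fst z).
Definition ex_dy (f : C -> R) (z : C) : Prop :=
  ex_derive (fun t => f (fst z, t)) (snd z).

(* Continuity of the function itself follows from that of its partial
   derivatives, the set being open. *)
Definition C1_on (U : C -> Prop) (f : C -> R) : Prop :=
  forall z, U z ->
    ex_dx f z /\ ex_dy f z /\ continuous (dx f) z /\ continuous (dy f) z.

Definition C2_on (U : C -> Prop) (f : C -> R) : Prop :=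
  C1_on U f /\ C1_on U (dx f) /\ C1_on U (dy f).

Definition laplacian (f : C -> R) (z : C) : R := dx (dx f) z + dy (dy f) z.

Definition cdx (u : C -> C) (z : C) : C :=
  (dx (fun p => Re (u p)) z, dx (fun p => Im (u p)) z).
Definition cdy (u : C -> C) (z : C) : C :=
  (dy (fun p => Re (u p)) z, dy (fun p => Im (u p)) z).

Definition d_z (u : C -> C) (z : C) : C :=
  (RtoC (/ 2) * (cdx u z - Ci * cdy u z))%C.
Definition d_zbar (u : C -> C) (z : C) : C :=
  (RtoC (/ 2) * (cdx u z + Ci * cdy u z))%C.

Definition BT (D : C -> Prop) (w theta : C -> R) : Prop :=
  pointed_domain D /\ C2_on D w /\ C2_on D theta /\
  (forall z, D z ->
     dx w z - dy theta z = - 2 * sinh (w z) * sin (theta z) /\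
     dy w z + dx theta z = - 2 * cosh (w z) * cos (theta z)).

Definition BT0 (D : C -> Prop) (w theta : C -> R) : Prop :=
  BT D w theta /\
  (forall x : R, D (x, 0) -> dy w (x, 0) = 0) /\
  theta (0, 0) = PI / 2.

(* The inverse of [tanh] on ]-1, 1[; outside it the value is junk. *)
Definition arctanh (r : R) : R := / 2 * ln ((1 + r) / (1 - r)).

Definition separated (D : C -> Prop) (w : C -> R) (F G : R -> R) : Prop :=
  forall x y : R, D (x, y) ->
    -1 < F x * G y < 1 /\ w (x, y) = 2 * arctanh (F x * G y).

(* [F] and [G] are total, but only their values on the projections of the
   domain to the two axes are meaningful, so non-constancy is required there. *)
Definition nonconstant_in_x (D : C -> Prop) (F : R -> R) : Prop :=
  exists x1 y1 x2 y2 : R, D (x1, y1) /\ D (x2, y2) /\ F x1 <> F x2.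
Definition nonconstant_in_y (D : C -> Prop) (G : R -> R) : Prop :=
  exists x1 y1 x2 y2 : R, D (x1, y1) /\ D (x2, y2) /\ G y1 <> G y2.

Definition b_of (F : R -> R) (x : R) : R := Derive F x / (2 * F x).

Definition X_of (w : C -> R) (x : R) : R :=
  RInt (fun t => cosh (w (t, 0))) 0 x.

(* The formulas for [R] and [S] make sense on [Om]: the axis segment from 0 to
   [x], along which [X] is integrated, lies in the domain [D] of [w] (so the
   integrand is continuous there), and [b x] and the quotients are defined. *)
Definition formulas_make_sense (D Om : C -> Prop) (F : R -> R) : Prop :=
  forall x y : R, Om (x, y) ->
    (forall t : R, Rmin 0 x <= t <= Rmax 0 x -> D (t, 0)) /\
    ex_derive F x /\ F x <> 0 /\ 1 + b_of F x <> 0.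

Definition sinh_gordon (U : C -> Prop) (w : C -> R) : Prop :=
  C2_on U w /\ (forall z, U z -> laplacian w z = 2 * sinh (2 * w z)).

(* The target metric is (dR^2 + dS^2) / S^2 with u = R + i S, and S may have
   either sign.  The condition [d_z u z <> 0] makes the Beltrami quotient meaningful, since
   division in [C] is total. *)
Definition corresponding_harmonic_map
    (U : C -> Prop) (w : C -> R) (u : C -> C) : Prop :=
  pointed_domain U /\ sinh_gordon U w /\
  C2_on U (fun z => Re (u z)) /\ C2_on U (fun z => Im (u z)) /\
  (forall z, U z ->
     Im (u z) <> 0 /\
     d_z u z <> RtoC 0 /\
     (d_zbar u z / d_z u z)%C = RtoC (exp (- 2 * w z)) /\
     (d_z (d_zbar u) z + Ci / RtoC (Im (u z)) * d_z u z * d_zbar u z)%C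
       = RtoC 0 /\
     (d_z u z * d_z (fun p => Cconj (u p)) z / RtoC (Im (u z) ^ 2))%C
       = RtoC 1).

(* Main.v *)
Require Import Defs.
From Stdlib Require Import Reals Lra Classical.
From Coquelicot Require Import Coquelicot.
Open Scope R_scope.

(** Write [K] for the logarithmic derivative of [exp (2 X) / (1 + b)]. The
    theorem reduces to four first order equations for [u = Rf + i Sf],
      [u_x = 2 cosh w Sf e^(i theta)],  [u_y = 2 i sinh w Sf e^(i theta)]
    ([moving_frame]). They give [u_z = e^w Sf e^(i theta)] and
    [u_zbar = e^(-w) Sf e^(i theta)], whence the Beltrami equation and the
    normalization, and the harmonic map equation becomes the Baecklund
    transformation itself ([frame_corresponding_harmonic]).

    Separation of variables means [w_x = 2 b sinh w] with [b] a function of [x]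
    alone. The transformation then gives [theta_y = 2 sinh w (b + sin theta)],
    from which the [y]-half of the frame equations is immediate. The [x]-half is
    equivalent to the alignment relation
      [(K - 2 b cosh w, w_y) = M (sin theta, - cos theta)]
    for an explicit [M]. It holds at the origin by the initial conditions, and
    its two components satisfy a homogeneous linear first order system in [x] as
    well as in [y]; Gronwall's inequality and connectedness carry it to the whole
    domain ([linear_system_zero], [frame_alignment]). The same argument shows
    that [sin theta + b] has no zero, so that [Sf] does not vanish
    ([separated_frame]).

    That the system in [x] closes up rests on a first integral on the real axis,
    [b' = 2 cosh w(x, 0) (1 - b^2) - k]. When [G 0 <> 0] it follows from the
    sinh-Gordon equation, because [w_yy(x, 0)] is a constant multiple of
    [sinh w(x, 0)] ([axis_curvature]). When [G 0 = 0], the solution [w] vanishes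
    with its gradient at the origin, hence identically by unique continuation
    ([separated_flat]); then [theta = PI / 2] modulo [2 PI], and the formulas
    agree with those for [b = 0]. *)

(** * Uniqueness for linear systems on a connected domain *)

Lemma locally_box (P : C -> Prop) (x y : R) :
  locally (x, y) P <-> locally_2d (fun u v => P (u, v)) x y.
Proof.
  rewrite locally_2d_locally.
  split; apply filter_imp; intros [u v]; auto.
Qed.

(** Along a path joining two points, the supremum of the times up to which [P]
    holds has a neighbourhood on which [P] is decided, so it can only be the
    final time. *)
Lemma locally_decided_constant (U P : C -> Prop) :
  path_connected U ->
  (forall z, U z -> locally z P \/ locally z (fun q => ~ P q)) ->
  forall p q, U p -> U q -> P p -> P q.
Proof.
  intros HU HP p q Hp Hq Pp.
  destruct (HU p q Hp Hq) as [g [[Hc Hg] [g0 g1]]].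
  set (A := fun t => unit_interval t /\ forall s, 0 <= s <= t -> P (g s)).
  assert (A0 : A 0).
  { split; [split; lra|]. intros s Hs. replace s with 0 by lra. now rewrite g0. }
  destruct (completeness A) as [m [Hub Hlub]].
  - exists 1. intros t [[_ Ht] _]; exact Ht.
  - now exists 0.
  - assert (Hm : unit_interval m).
    { split; [now apply Hub|]. apply Hlub. intros t [[_ Ht] _]; exact Ht. }
    assert (loc : exists d, 0 < d /\
       ((forall t, unit_interval t -> Rabs (t - m) < d -> P (g t)) \/
        (forall t, unit_interval t -> Rabs (t - m) < d -> ~ P (g t)))).
    { destruct (HP (g m) (Hg m Hm)) as [H|H];
        destruct (Hc m Hm _ H) as [d Hd]; exists d; (split; [apply cond_pos|]);
        [left|right]; intros t Ht Htd; apply Hd; auto. }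
    destruct loc as [d [d0 loc]].
    assert (Ha : exists a, A a /\ m - d < a).
    { apply NNPP; intros N. assert (m <= m - d); [|lra].
      apply Hlub. intros t At. apply Rnot_lt_le. intros Hlt. apply N. now exists t. }
    destruct Ha as [a [[[a0 a1] Aa] Hma]].
    assert (Ham : a <= m) by (apply Hub; split; [split|]; auto).
    assert (Hda : Rabs (a - m) < d) by (apply Rabs_def1; lra).
    destruct loc as [loc|loc].
    2:{ exfalso. apply (loc a); [split; auto|auto|]. apply Aa; lra. }
    assert (At : A (Rmin 1 (m + d / 2))).
    { destruct Hm as [m0 m1]. split.
      - split; [apply Rmin_glb; lra|apply Rmin_l].
      - intros s [s0 Hs].
        assert (Hs1 := Rle_trans _ _ _ Hs (Rmin_l _ _)).
        assert (Hs2 := Rle_trans _ _ _ Hs (Rmin_r _ _)).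
        destruct (Rle_dec s a); [apply Aa; lra|].
        apply loc; [split; lra|apply Rabs_def1; lra]. }
    assert (H1 := Hub _ At).
    rewrite <- g1. apply At. split; [lra|]. apply Rmin_glb; [lra|].
    unfold Rmin in H1. destruct (Rle_dec 1 (m + d / 2)); lra.
Qed.

(** Gronwall's inequality for the value 0, in both directions of time: with [e]
    the sign of [b - a], [h^2 exp (- 2 K e t)] does not increase from [a] to [b]. *)
Lemma gronwall_zero (h h' : R -> R) (K a b : R) :
  (forall t, Rmin a b <= t <= Rmax a b -> is_derive h t (h' t)) ->
  (forall t, Rmin a b <= t <= Rmax a b -> Rabs (h' t) <= K * Rabs (h t)) ->
  h a = 0 -> h b = 0.
Proof.
  intros Hd Hb Ha.
  assert (He : exists e, e * e = 1 /\ 0 <= e * (b - a)).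
  { destruct (Rle_dec a b); [exists 1|exists (-1)]; lra. }
  destruct He as [e [He Hab]].
  set (phi := fun t => (h t)^2 * exp (- 2 * K * e * t)).
  set (dphi := fun t => 2 * (h t * h' t - K * e * (h t)^2) * exp (- 2 * K * e * t)).
  assert (Hphi : forall t, Rmin a b <= t <= Rmax a b -> is_derive phi t (dphi t)).
  { intros t Ht. specialize (Hd t Ht). unfold phi, dphi.
    auto_derive; [now exists (h' t)|].
    replace (Derive (fun x => h x) t) with (h' t)
      by (symmetry; now apply is_derive_unique). ring. }
  destruct (MVT_gen phi a b dphi) as [c [Hc Heq]].
  - intros t Ht. apply Hphi; lra.
  - intros t Ht. apply derivable_continuous_pt. exists (dphi t).
    apply is_derive_Reals. now apply Hphi.
  - assert (Hle : dphi c * (b - a) <= 0).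
    { replace (dphi c * (b - a)) with
        (2 * (e * (h c * h' c) - K * (h c)^2) * (e * (b - a)) * exp (- 2 * K * e * c)).
      2:{ unfold dphi. replace (h c * h' c) with (e * e * (h c * h' c)) at 2
            by (rewrite He; ring). ring_simplify. ring. }
      assert (Hk : e * (h c * h' c) - K * (h c)^2 <= 0).
      { specialize (Hb c Hc). assert (Habs : e * (h c * h' c) <= Rabs (h c) * Rabs (h' c)).
        { assert (Hm : Rabs e = 1).
          { unfold Rabs. destruct (Rcase_abs e); nra. }
          rewrite <- (Rmult_1_l (Rabs (h c) * _)), <- Hm, <- !Rabs_mult.
          apply Rle_abs. }
        assert (H2 := Rmult_le_compat_l _ _ _ (Rabs_pos (h c)) Hb).
        assert (H3 : Rabs (h c) * Rabs (h c) = (h c)^2)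
          by (rewrite <- Rabs_mult, Rabs_right; nra).
        replace (K * (h c)^2) with (Rabs (h c) * (K * Rabs (h c))) by (rewrite <- H3; ring).
        lra. }
      assert (Hexp := exp_pos (- 2 * K * e * c)).
      assert (0 <= e * (b - a) * exp (- 2 * K * e * c)) by (apply Rmult_le_pos; lra).
      nra. }
    assert (Hpa : phi a = 0) by (unfold phi; rewrite Ha; ring).
    assert (Hpb : (h b)^2 * exp (- 2 * K * e * b) <= 0) by (fold (phi b); lra).
    assert (Hexp := exp_pos (- 2 * K * e * b)).
    assert (0 <= (h b)^2) by nra. assert ((h b)^2 <= 0) by nra. nra.
Qed.

Lemma continuous_locally_bounded (k : C -> R) (z : C) :
  continuous k z -> locally z (fun p => Rabs (k p) < Rabs (k z) + 1).
Proof.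
  intros Hk.
  apply (filter_imp (fun p => ball (k z) 1 (k p))).
  - intros p Hp. change (Rabs (k p - k z) < 1) in Hp.
    assert (H := Rabs_triang_inv (k p) (k z)). lra.
  - apply Hk. exists (mkposreal 1 Rlt_0_1). now intros.
Qed.

Lemma continuous_neq0_locally {T : UniformSpace} (f : T -> R) (z : T) :
  continuous f z -> f z <> 0 -> locally z (fun p => f p <> 0).
Proof.
  intros Hc Hz. apply (Hc (fun r => r <> 0)). exists (mkposreal _ (Rabs_pos_lt _ Hz)).
  intros r Hr Hr0. change (Rabs (r - f z) < Rabs (f z)) in Hr.
  rewrite Hr0, Rminus_0_l, Rabs_Ropp in Hr. lra.
Qed.

Lemma between_close (x d u v t : R) :
  Rabs (u - x) < d -> Rabs (v - x) < d -> Rmin u v <= t <= Rmax u v ->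
  Rabs (t - x) < d.
Proof.
  intros Hu Hv Ht. apply Rabs_def2 in Hu. apply Rabs_def2 in Hv.
  revert Ht. unfold Rmin, Rmax. destruct (Rle_dec u v); intros; apply Rabs_def1; lra.
Qed.

(** Inside a box on which [k] is bounded, any two points are joined by a
    horizontal and a vertical segment, and Gronwall applies on both; so the
    vanishing of [g] is locally decided. *)
Lemma zero_propagates (U : C -> Prop) (g gx gy k : C -> R) :
  open U -> path_connected U ->
  (forall x y, U (x, y) ->
     is_derive (fun t : R => g (t, y)) x (gx (x, y)) /\
     is_derive (fun t : R => g (x, t)) y (gy (x, y)) /\
     Rabs (gx (x, y)) <= k (x, y) * Rabs (g (x, y)) /\
     Rabs (gy (x, y)) <= k (x, y) * Rabs (g (x, y))) ->
  (forall z, U z -> continuous k z) ->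
  forall p q, U p -> U q -> g p = 0 -> g q = 0.
Proof.
  intros HO HU Hg Hk. apply locally_decided_constant; [exact HU|].
  intros [x0 y0] Hz.
  assert (Hloc : locally (x0, y0)
            (fun z => U z /\ Rabs (k z) < Rabs (k (x0, y0)) + 1)).
  { apply filter_and; [now apply HO|]. now apply continuous_locally_bounded, Hk. }
  apply locally_box in Hloc. destruct Hloc as [d Hd].
  set (B := Rabs (k (x0, y0)) + 1) in *.
  assert (Hbound : forall x y, Rabs (x - x0) < d -> Rabs (y - y0) < d ->
     is_derive (fun t : R => g (t, y)) x (gx (x, y)) /\
     is_derive (fun t : R => g (x, t)) y (gy (x, y)) /\
     Rabs (gx (x, y)) <= B * Rabs (g (x, y)) /\
     Rabs (gy (x, y)) <= B * Rabs (g (x, y))).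
  { intros x y Hx Hy. destruct (Hd x y Hx Hy) as [HUxy HB].
    destruct (Hg x y HUxy) as [H1 [H2 [H3 H4]]].
    assert (HkB : k (x, y) <= B) by (eapply Rle_trans; [apply Rle_abs|now left]).
    assert (H5 := Rmult_le_compat_r _ _ _ (Rabs_pos (g (x, y))) HkB).
    split; [exact H1|split; [exact H2|split; lra]]. }
  assert (Heq : forall x y u v, Rabs (x - x0) < d -> Rabs (y - y0) < d ->
            Rabs (u - x0) < d -> Rabs (v - y0) < d -> g (x, y) = 0 -> g (u, v) = 0).
  { intros x y u v Hx Hy Hu Hv H0.
    apply (gronwall_zero (fun t : R => g (u, t)) (fun t : R => gy (u, t)) B y v).
    - intros t Ht. apply Hbound; auto. now apply (between_close y0 d y v t).
    - intros t Ht. apply Hbound; auto. now apply (between_close y0 d y v t).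
    - apply (gronwall_zero (fun t : R => g (t, y)) (fun t : R => gx (t, y)) B x u); auto.
      + intros t Ht. apply Hbound; auto. now apply (between_close x0 d x u t).
      + intros t Ht. apply Hbound; auto. now apply (between_close x0 d x u t). }
  assert (Hx0 : Rabs (x0 - x0) < d) by (rewrite Rminus_eq_0, Rabs_R0; apply cond_pos).
  assert (Hy0 : Rabs (y0 - y0) < d) by (rewrite Rminus_eq_0, Rabs_R0; apply cond_pos).
  destruct (Req_dec (g (x0, y0)) 0) as [H0|H0]; [left|right];
    apply locally_box; exists d; intros u v Hu Hv.
  - now apply (Heq x0 y0 u v).
  - intros H. apply H0. now apply (Heq u v x0 y0).
Qed.

(** The arithmetic and composition rules below, for continuity and later for
    derivatives, repeat the general ones at real-valued functions, so that
    they can be applied by the syntactic shape of the goal. *)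
Lemma continuous_Rplus (f g : C -> R) z :
  continuous f z -> continuous g z -> continuous (fun p => f p + g p) z.
Proof. exact (fun Hf Hg => continuous_plus f g z Hf Hg). Qed.

Lemma continuous_Rminus (f g : C -> R) z :
  continuous f z -> continuous g z -> continuous (fun p => f p - g p) z.
Proof. exact (fun Hf Hg => continuous_minus f g z Hf Hg). Qed.

Lemma continuous_Ropp (f : C -> R) z :
  continuous f z -> continuous (fun p => - f p) z.
Proof. exact (fun Hf => continuous_opp f z Hf). Qed.

Lemma continuous_Rmult (f g : C -> R) z :
  continuous f z -> continuous g z -> continuous (fun p => f p * g p) z.
Proof. exact (fun Hf Hg => continuous_mult f g z Hf Hg). Qed.

Lemma continuous_of_is_derive (f : R -> R) (l x : R) :
  is_derive f x l -> continuous f x.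
Proof. intros H. apply (ex_derive_continuous f). now exists l. Qed.

Lemma is_derive_cosh (x : R) : is_derive cosh x (sinh x).
Proof. apply is_derive_Reals, derivable_pt_lim_cosh. Qed.

Lemma is_derive_sinh (x : R) : is_derive sinh x (cosh x).
Proof. apply is_derive_Reals, derivable_pt_lim_sinh. Qed.

Lemma continuous_comp_R (phi : R -> R) (f : C -> R) z :
  continuous phi (f z) -> continuous f z -> continuous (fun p => phi (f p)) z.
Proof. intros Hp Hf. now apply (continuous_comp f phi). Qed.

Lemma continuous_fst_comp (phi : R -> R) (x y : R) :
  continuous phi x -> continuous (fun p : C => phi (fst p)) (x, y).
Proof.
  intros H. apply (continuous_comp (fst : C -> R) phi); [|exact H].
  apply (continuous_fst (x : R_UniformSpace) (y : R_UniformSpace)).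
Qed.

Ltac solve_continuous :=
  cbv beta;
  repeat
    lazymatch goal with
    | |- continuous (fun _ => _ + _) _ => apply continuous_Rplus
    | |- continuous (fun _ => _ - _) _ => apply continuous_Rminus
    | |- continuous (fun _ => _ * _) _ => apply continuous_Rmult
    | |- continuous (fun _ => - _) _ => apply continuous_Ropp
    | |- continuous (fun _ => Rabs _) _ =>
        apply (continuous_comp_R Rabs); [apply continuous_Rabs|]
    | |- continuous (fun _ => cosh _) _ =>
        apply (continuous_comp_R cosh);
          [apply (continuous_of_is_derive _ _ _ (is_derive_cosh _))|]
    | |- continuous (fun _ => sinh _) _ =>
        apply (continuous_comp_R sinh);
          [apply (continuous_of_is_derive _ _ _ (is_derive_sinh _))|]
    | |- continuous (fun _ => cos _) _ =>
        apply (continuous_comp_R cos);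
          [apply (continuous_of_is_derive _ _ _ (is_derive_cos _))|]
    | |- continuous (fun _ => sin _) _ =>
        apply (continuous_comp_R sin);
          [apply (continuous_of_is_derive _ _ _ (is_derive_sin _))|]
    | |- continuous (fun _ => ?a) _ => apply (continuous_const a)
    | |- continuous _ _ => eassumption
    end.

(** The function [f^2 + g^2] satisfies the scalar inequality of
    [zero_propagates], with the sum of the absolute values of the coefficients
    as rate. *)
Lemma linear_system_zero (U : C -> Prop) (f g a11 a12 a21 a22 b11 b12 b21 b22 : C -> R) :
  open U -> path_connected U ->
  (forall x y, U (x, y) ->
     is_derive (fun t : R => f (t, y)) x (a11 (x, y) * f (x, y) + a12 (x, y) * g (x, y)) /\
     is_derive (fun t : R => g (t, y)) x (a21 (x, y) * f (x, y) + a22 (x, y) * g (x, y)) /\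
     is_derive (fun t : R => f (x, t)) y (b11 (x, y) * f (x, y) + b12 (x, y) * g (x, y)) /\
     is_derive (fun t : R => g (x, t)) y (b21 (x, y) * f (x, y) + b22 (x, y) * g (x, y))) ->
  (forall z, U z ->
     (continuous a11 z /\ continuous a12 z /\ continuous a21 z /\ continuous a22 z) /\
     (continuous b11 z /\ continuous b12 z /\ continuous b21 z /\ continuous b22 z)) ->
  forall p q, U p -> U q -> f p = 0 -> g p = 0 -> f q = 0 /\ g q = 0.
Proof.
  intros HO HU Hd Hc p q Hp Hq Hfp Hgp.
  assert (Hsum : f q * f q + g q * g q = 0).
  2:{ assert (0 <= f q * f q) by nra. assert (0 <= g q * g q) by nra.
      split; apply Rsqr_0_uniq; unfold Rsqr; lra. }
  apply (zero_propagates U (fun z => f z * f z + g z * g z)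
    (fun z => 2 * (f z * (a11 z * f z + a12 z * g z) + g z * (a21 z * f z + a22 z * g z)))
    (fun z => 2 * (f z * (b11 z * f z + b12 z * g z) + g z * (b21 z * f z + b22 z * g z)))
    (fun z => 2 * ((Rabs (a11 z) + Rabs (a12 z) + Rabs (a21 z) + Rabs (a22 z))
                   + (Rabs (b11 z) + Rabs (b12 z) + Rabs (b21 z) + Rabs (b22 z))))) with p;
    auto; [| |rewrite Hfp, Hgp; ring].
  - intros x y Hxy. destruct (Hd x y Hxy) as [D1 [D2 [D3 D4]]].
    assert (Dsq : forall (h k : R -> R) t h' k', is_derive h t h' -> is_derive k t k' ->
              is_derive (fun t : R => h t * h t + k t * k t) t (2 * (h t * h' + k t * k'))).
    { intros h k t h' k' Hh Hk. assert (ex_derive h t) by now exists h'.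
      assert (ex_derive k t) by now exists k'. auto_derive; [tauto|].
      replace (Derive (fun x => h x) t) with h' by (symmetry; now apply is_derive_unique).
      replace (Derive (fun x => k x) t) with k' by (symmetry; now apply is_derive_unique).
      ring. }
    split; [exact (Dsq (fun t : R => f (t, y)) (fun t : R => g (t, y)) _ _ _ D1 D2)|].
    split; [exact (Dsq (fun t : R => f (x, t)) (fun t : R => g (x, t)) _ _ _ D3 D4)|].
    assert (Hq4 : forall A B m1 m2 m3 m4 N, 0 <= N ->
       Rabs (2 * (A * (m1 * A + m2 * B) + B * (m3 * A + m4 * B))) <=
       2 * ((Rabs m1 + Rabs m2 + Rabs m3 + Rabs m4) + N) * Rabs (A * A + B * B)).
    { intros A B m1 m2 m3 m4 N HN.
      rewrite (Rabs_right (A * A + B * B)) by nra.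
      assert (Hm : forall m v T, Rabs v <= T -> Rabs (m * v) <= Rabs m * T).
      { intros m v T Hv. rewrite Rabs_mult. apply Rmult_le_compat_l; [apply Rabs_pos|auto]. }
      assert (Hv1 : Rabs (A * A) <= A * A + B * B) by (rewrite Rabs_right; nra).
      assert (Hv2 : Rabs (A * B) <= A * A + B * B) by (apply Rabs_le; nra).
      assert (Hv4 : Rabs (B * B) <= A * A + B * B) by (rewrite Rabs_right; nra).
      replace (2 * (A * (m1 * A + m2 * B) + B * (m3 * A + m4 * B))) with
        (2 * (m1 * (A * A) + m2 * (A * B) + m3 * (A * B) + m4 * (B * B))) by ring.
      rewrite Rabs_mult, (Rabs_right 2) by lra.
      assert (H1 := Hm m1 _ _ Hv1). assert (H2 := Hm m2 _ _ Hv2).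
      assert (H3 := Hm m3 _ _ Hv2). assert (H4 := Hm m4 _ _ Hv4).
      assert (T1 := Rabs_triang (m1 * (A * A) + m2 * (A * B) + m3 * (A * B)) (m4 * (B * B))).
      assert (T2 := Rabs_triang (m1 * (A * A) + m2 * (A * B)) (m3 * (A * B))).
      assert (T3 := Rabs_triang (m1 * (A * A)) (m2 * (A * B))).
      assert (0 <= N * (A * A + B * B)) by (apply Rmult_le_pos; nra).
      nra. }
    assert (Hsum4 : forall m1 m2 m3 m4, 0 <= Rabs m1 + Rabs m2 + Rabs m3 + Rabs m4).
    { intros. assert (X1 := Rabs_pos m1). assert (X2 := Rabs_pos m2).
      assert (X3 := Rabs_pos m3). assert (X4 := Rabs_pos m4). lra. }
    split; [apply Hq4, Hsum4|].
    rewrite (Rplus_comm (Rabs (a11 (x, y)) + _ + _ + _)). apply Hq4, Hsum4.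
  - intros z Hz. destruct (Hc z Hz) as [[? [? [? ?]]] [? [? [? ?]]]].
    solve_continuous.
Qed.

(** * Calculus of partial derivatives *)

Lemma open_in_x (U : C -> Prop) x y : open U -> U (x, y) -> locally x (fun t : R => U (t, y)).
Proof.
  intros HO H. apply HO, locally_box in H. destruct H as [d Hd]. exists d.
  intros t Ht. apply Hd; [exact Ht|]. rewrite Rminus_eq_0, Rabs_R0. apply cond_pos.
Qed.

Lemma open_in_y (U : C -> Prop) x y : open U -> U (x, y) -> locally y (fun t : R => U (x, t)).
Proof.
  intros HO H. apply HO, locally_box in H. destruct H as [d Hd]. exists d.
  intros t Ht. apply Hd; [|exact Ht]. rewrite Rminus_eq_0, Rabs_R0. apply cond_pos.
Qed.

Lemma C1_derive_x (U : C -> Prop) f x y :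
  C1_on U f -> U (x, y) -> is_derive (fun t : R => f (t, y)) x (dx f (x, y)).
Proof. intros Hf H. apply Derive_correct, (Hf (x, y) H). Qed.

Lemma C1_derive_y (U : C -> Prop) f x y :
  C1_on U f -> U (x, y) -> is_derive (fun t : R => f (x, t)) y (dy f (x, y)).
Proof. intros Hf H. apply Derive_correct, (Hf (x, y) H). Qed.

Lemma C1_continuous (U : C -> Prop) f z :
  open U -> C1_on U f -> U z -> continuous f z.
Proof.
  intros HO Hf Hz. destruct z as [x y].
  assert (Hd := is_derive_filterdiff (fun u v => f (u, v)) x y
                  (fun u v => dx f (u, v)) (dy f (x, y))).
  assert (Hc : continuous (fun u : R * R => f (fst u, snd u)) (x, y)).
  { apply (filterdiff_continuous (K := R_AbsRing)
      (U := prod_NormedModule R_AbsRing R_NormedModule R_NormedModule)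
      (V := R_NormedModule) (fun u => f (fst u, snd u))).
    eexists. apply Hd.
    - apply (filter_imp U); [|now apply HO].
      intros [u v] Huv. now apply (C1_derive_x U).
    - now apply (C1_derive_y U).
    - apply (continuous_ext (dx f)); [now intros []|]. apply (Hf (x, y) Hz). }
  revert Hc. apply continuous_ext. now intros [].
Qed.

Lemma C1_intro (U : C -> Prop) (f fx fy : C -> R) :
  open U ->
  (forall x y, U (x, y) -> is_derive (fun t : R => f (t, y)) x (fx (x, y)) /\
                           is_derive (fun t : R => f (x, t)) y (fy (x, y))) ->
  (forall z, U z -> continuous fx z /\ continuous fy z) ->
  C1_on U f /\ (forall z, U z -> dx f z = fx z /\ dy f z = fy z).
Proof.
  intros HO Hd Hc.
  assert (Heq : forall z, U z -> dx f z = fx z /\ dy f z = fy z).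
  { intros [x y] Hz. destruct (Hd x y Hz) as [H1 H2].
    split; now apply is_derive_unique. }
  split; [|exact Heq]. intros [x y] Hz.
  destruct (Hd x y Hz) as [H1 H2].
  split; [eexists; exact H1|]. split; [eexists; exact H2|].
  destruct (Hc _ Hz) as [C1 C2].
  split; [apply (continuous_ext_loc (dx f) fx); [|exact C1]
         |apply (continuous_ext_loc (dy f) fy); [|exact C2]];
    apply (filter_imp U); try (now apply HO); intros p Hp; symmetry; now apply Heq.
Qed.

Lemma is_derive_x_ext (U : C -> Prop) (f g : C -> R) x y l :
  open U -> (forall z, U z -> f z = g z) -> U (x, y) ->
  is_derive (fun t : R => g (t, y)) x l -> is_derive (fun t : R => f (t, y)) x l.
Proof.
  intros HO Hfg Hz. apply is_derive_ext_loc.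
  apply (filter_imp (fun t : R => U (t, y))); [|now apply open_in_x].
  intros t Ht. symmetry. now apply Hfg.
Qed.

Lemma is_derive_y_ext (U : C -> Prop) (f g : C -> R) x y l :
  open U -> (forall z, U z -> f z = g z) -> U (x, y) ->
  is_derive (fun t : R => g (x, t)) y l -> is_derive (fun t : R => f (x, t)) y l.
Proof.
  intros HO Hfg Hz. apply is_derive_ext_loc.
  apply (filter_imp (fun t : R => U (x, t))); [|now apply open_in_y].
  intros t Ht. symmetry. now apply Hfg.
Qed.

Lemma C1_ext (U : C -> Prop) (f g : C -> R) :
  open U -> (forall z, U z -> f z = g z) -> C1_on U g -> C1_on U f.
Proof.
  intros HO Hfg Hg. apply (C1_intro U f (dx g) (dy g) HO).
  - intros x y Hz. split.
    + apply (is_derive_x_ext U f g); auto. now apply (C1_derive_x U).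
    + apply (is_derive_y_ext U f g); auto. now apply (C1_derive_y U).
  - intros z Hz. apply (Hg z Hz).
Qed.

Lemma C1_mult (U : C -> Prop) (f g : C -> R) :
  open U -> C1_on U f -> C1_on U g -> C1_on U (fun z => f z * g z).
Proof.
  intros HO Hf Hg.
  apply (C1_intro U _ (fun z => dx f z * g z + f z * dx g z)
                      (fun z => dy f z * g z + f z * dy g z) HO).
  - intros x y Hz. split.
    + apply (is_derive_mult (fun t : R => f (t, y)) (fun t : R => g (t, y)));
        [now apply (C1_derive_x U)|now apply (C1_derive_x U)|intros; apply Rmult_comm].
    + apply (is_derive_mult (fun t : R => f (x, t)) (fun t : R => g (x, t)));
        [now apply (C1_derive_y U)|now apply (C1_derive_y U)|intros; apply Rmult_comm].
  - intros z Hz. assert (Cf := C1_continuous U f z HO Hf Hz).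
    assert (Cg := C1_continuous U g z HO Hg Hz).
    destruct (Hf z Hz) as [_ [_ [? ?]]]. destruct (Hg z Hz) as [_ [_ [? ?]]].
    split; solve_continuous.
Qed.

Lemma C1_comp (U : C -> Prop) (phi phi' : R -> R) (f : C -> R) :
  open U -> (forall t, is_derive phi t (phi' t)) -> (forall t, continuous phi' t) ->
  C1_on U f -> C1_on U (fun z => phi (f z)).
Proof.
  intros HO Hphi Hc Hf.
  apply (C1_intro U _ (fun z => dx f z * phi' (f z)) (fun z => dy f z * phi' (f z)) HO).
  - intros x y Hz. split.
    + apply (is_derive_comp phi (fun t : R => f (t, y))); [apply Hphi|now apply (C1_derive_x U)].
    + apply (is_derive_comp phi (fun t : R => f (x, t))); [apply Hphi|now apply (C1_derive_y U)].
  - intros z Hz. assert (Cf := C1_continuous U f z HO Hf Hz).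
    destruct (Hf z Hz) as [_ [_ [? ?]]].
    split; apply continuous_Rmult; auto; apply (continuous_comp_R phi'); auto.
Qed.

Lemma C1_cosh (U : C -> Prop) f : open U -> C1_on U f -> C1_on U (fun z => cosh (f z)).
Proof.
  intros HO. apply (C1_comp U cosh sinh); auto using is_derive_cosh.
  intros t. exact (continuous_of_is_derive _ _ _ (is_derive_sinh t)).
Qed.

Lemma C1_sinh (U : C -> Prop) f : open U -> C1_on U f -> C1_on U (fun z => sinh (f z)).
Proof.
  intros HO. apply (C1_comp U sinh cosh); auto using is_derive_sinh.
  intros t. exact (continuous_of_is_derive _ _ _ (is_derive_cosh t)).
Qed.

Lemma C1_sin (U : C -> Prop) f : open U -> C1_on U f -> C1_on U (fun z => sin (f z)).
Proof.
  intros HO. apply (C1_comp U sin cos); auto using is_derive_sin.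
  intros t. exact (continuous_of_is_derive _ _ _ (is_derive_cos t)).
Qed.

Lemma C1_cos (U : C -> Prop) f : open U -> C1_on U f -> C1_on U (fun z => cos (f z)).
Proof.
  intros HO. apply (C1_comp U cos (fun t : R => - sin t)); auto using is_derive_cos.
  intros t. apply (continuous_opp sin).
  exact (continuous_of_is_derive _ _ _ (is_derive_sin t)).
Qed.

Lemma C1_scal (U : C -> Prop) (a : R) f : open U -> C1_on U f -> C1_on U (fun z => a * f z).
Proof.
  intros HO. apply (C1_comp U (fun t : R => a * t) (fun _ => a)); auto.
  - intros t. auto_derive; [auto|ring].
  - intros t. apply continuous_const.
Qed.

Lemma mixed_partials (U : C -> Prop) (f : C -> R) z :
  open U -> C2_on U f -> U z -> dx (dy f) z = dy (dx f) z.
Proof.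
  intros HO [Hf [Hfx Hfy]] Hz. destruct z as [x y].
  apply (Schwarz (fun u v => f (u, v)) x y).
  - apply (locally_2d_locally (fun u v => _)).
    apply (filter_imp U); [|now apply HO]. intros [u v] Huv.
    destruct (Hf _ Huv) as [? [? _]]. destruct (Hfx _ Huv) as [_ [? _]].
    destruct (Hfy _ Huv) as [? _].
    split; [assumption|]. split; [assumption|]. split; assumption.
  - apply continuity_2d_pt_filterlim.
    apply (continuous_ext (dx (dy f))); [now intros []|]. apply (Hfy _ Hz).
  - apply continuity_2d_pt_filterlim.
    apply (continuous_ext (dy (dx f))); [now intros []|]. apply (Hfx _ Hz).
Qed.

(** * Hyperbolic functions and rules of differentiation *)

Lemma is_derive_value (f : R -> R) (x l l' : R) :
  is_derive f x l -> l = l' -> is_derive f x l'.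
Proof. now intros H <-. Qed.

Lemma is_derive_Rconst (a x : R) : is_derive (fun _ : R => a) x 0.
Proof. apply (is_derive_const (K := R_AbsRing) (V := R_NormedModule)). Qed.

Lemma is_derive_Rplus (f g : R -> R) (x f' g' : R) :
  is_derive f x f' -> is_derive g x g' -> is_derive (fun t : R => f t + g t) x (f' + g').
Proof. exact (fun Hf Hg => is_derive_plus f g x f' g' Hf Hg). Qed.

Lemma is_derive_Rminus (f g : R -> R) (x f' g' : R) :
  is_derive f x f' -> is_derive g x g' -> is_derive (fun t : R => f t - g t) x (f' - g').
Proof. exact (fun Hf Hg => is_derive_minus f g x f' g' Hf Hg). Qed.

Lemma is_derive_Ropp (f : R -> R) (x f' : R) :
  is_derive f x f' -> is_derive (fun t : R => - f t) x (- f').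
Proof. exact (fun Hf => is_derive_opp f x f' Hf). Qed.

Lemma is_derive_Rmult (f g : R -> R) (x f' g' : R) :
  is_derive f x f' -> is_derive g x g' ->
  is_derive (fun t : R => f t * g t) x (f' * g x + f x * g').
Proof. exact (fun Hf Hg => is_derive_mult f g x f' g' Hf Hg Rmult_comm). Qed.

Lemma is_derive_Rdiv (f g : R -> R) (x f' g' : R) :
  is_derive f x f' -> is_derive g x g' -> g x <> 0 ->
  is_derive (fun t : R => f t / g t) x ((f' * g x - f x * g') / (g x)^2).
Proof. exact (fun Hf Hg => is_derive_div f g x f' g' Hf Hg). Qed.

Lemma is_derive_chain (phi f : R -> R) (x phi' f' : R) :
  is_derive phi (f x) phi' -> is_derive f x f' ->
  is_derive (fun t : R => phi (f t)) x (f' * phi').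
Proof. exact (fun Hp Hf => is_derive_comp phi f x phi' f' Hp Hf). Qed.

Ltac differentiate :=
  cbv beta;
  repeat
      lazymatch goal with
      | |- is_derive (fun _ => _ + _) _ _ => eapply is_derive_Rplus
      | |- is_derive (fun _ => _ - _) _ _ => eapply is_derive_Rminus
      | |- is_derive (fun _ => _ * _) _ _ => eapply is_derive_Rmult
      | |- is_derive (fun _ => _ / _) _ _ => eapply is_derive_Rdiv
      | |- is_derive (fun _ => - _) _ _ => eapply is_derive_Ropp
      | |- is_derive (fun _ => cosh _) _ _ =>
          eapply (is_derive_chain cosh); [apply is_derive_cosh|]
      | |- is_derive (fun _ => sinh _) _ _ =>
          eapply (is_derive_chain sinh); [apply is_derive_sinh|]
      | |- is_derive (fun _ => exp _) _ _ =>
          eapply (is_derive_chain exp); [apply is_derive_exp|]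
      | |- is_derive (fun _ => cos _) _ _ =>
          eapply (is_derive_chain cos); [apply is_derive_cos|]
      | |- is_derive (fun _ => sin _) _ _ =>
          eapply (is_derive_chain sin); [apply is_derive_sin|]
      | |- is_derive (fun _ => ?a) _ _ => apply (is_derive_Rconst a)
      | |- is_derive _ _ _ => eassumption
      end.

Ltac compute_derivative :=
  eapply is_derive_value;
    [differentiate|cbv beta; change (AbsRing.sort R_AbsRing) with R].

Lemma cosh_sinh_sq (t : R) : cosh t * cosh t = 1 + sinh t * sinh t.
Proof.
  unfold cosh, sinh. assert (H : exp t * exp (- t) = 1)
    by (rewrite <- exp_plus, Rplus_opp_r; apply exp_0).
  nra.
Qed.

Lemma sin_cos_sq (t : R) : sin t * sin t = 1 - cos t * cos t.
Proof. assert (H := sin2_cos2 t). unfold Rsqr in H. lra. Qed.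

Lemma sinh_double (t : R) : sinh (2 * t) = 2 * sinh t * cosh t.
Proof.
  unfold cosh, sinh. replace (2 * t) with (t + t) by ring.
  replace (- (t + t)) with (- t + - t) by ring. rewrite !exp_plus. field.
Qed.

Lemma exp_cosh_sinh (t : R) : exp t = cosh t + sinh t.
Proof. unfold cosh, sinh. field. Qed.

Lemma exp_opp_cosh_sinh (t : R) : exp (- t) = cosh t - sinh t.
Proof. unfold cosh, sinh. field. Qed.

(** * From a moving frame to the harmonic map *)

Definition backlund (U : C -> Prop) (w theta : C -> R) : Prop :=
  forall z, U z ->
     dx w z - dy theta z = - 2 * sinh (w z) * sin (theta z) /\
     dy w z + dx theta z = - 2 * cosh (w z) * cos (theta z).

(** Differentiating the first equation in [x] and the second in [y], the mixed
    derivatives of [theta] cancel; the first derivatives of [theta] that remain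
    are eliminated with the two equations themselves. *)
Lemma backlund_sinh_gordon (U : C -> Prop) (w theta : C -> R) :
  open U -> C2_on U w -> C2_on U theta -> backlund U w theta -> sinh_gordon U w.
Proof.
  intros HO Hw Ht HB. split; [exact Hw|].
  intros [x y] Hz. unfold laplacian.
  assert (Hmix := mixed_partials U theta (x, y) HO Ht Hz).
  destruct Hw as [Hw [Hwx Hwy]]. destruct Ht as [Ht [Htx Hty]].
  assert (W1 := C1_derive_x U w x y Hw Hz). assert (W2 := C1_derive_y U w x y Hw Hz).
  assert (T1 := C1_derive_x U theta x y Ht Hz). assert (T2 := C1_derive_y U theta x y Ht Hz).
  assert (T12 := C1_derive_x U (dy theta) x y Hty Hz).
  assert (T21 := C1_derive_y U (dx theta) x y Htx Hz).
  assert (Exx : is_derive (fun t : R => dx w (t, y)) x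
     (dx (dy theta) (x, y) - 2 * (cosh (w (x, y)) * dx w (x, y) * sin (theta (x, y))
       + sinh (w (x, y)) * cos (theta (x, y)) * dx theta (x, y)))).
  { apply (is_derive_x_ext U _ (fun z => dy theta z - 2 * (sinh (w z) * sin (theta z))));
      [exact HO| |exact Hz|].
    - intros z Uz. destruct (HB z Uz). lra.
    - compute_derivative. ring. }
  assert (Eyy : is_derive (fun t : R => dy w (x, t)) y
     (- dy (dx theta) (x, y) - 2 * (sinh (w (x, y)) * dy w (x, y) * cos (theta (x, y))
       - cosh (w (x, y)) * sin (theta (x, y)) * dy theta (x, y)))).
  { apply (is_derive_y_ext U _ (fun z => - dx theta z - 2 * (cosh (w z) * cos (theta z))));
      [exact HO| |exact Hz|].
    - intros z Uz. destruct (HB z Uz). lra.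
    - compute_derivative. ring. }
  apply is_derive_unique in Exx. apply is_derive_unique in Eyy.
  change (Derive (fun t : R => dx w (t, y)) x + Derive (fun t : R => dy w (x, t)) y
          = 2 * sinh (2 * w (x, y))).
  rewrite Exx, Eyy, Hmix, sinh_double.
  destruct (HB _ Hz) as [B1 B2].
  assert (Hs := sin_cos_sq (theta (x, y))).
  replace (dy theta (x, y)) with (dx w (x, y) + 2 * sinh (w (x, y)) * sin (theta (x, y))) by lra.
  replace (dx theta (x, y)) with (- dy w (x, y) - 2 * cosh (w (x, y)) * cos (theta (x, y))) by lra.
  ring_simplify. replace (sin (theta (x, y)) ^ 2) with (1 - cos (theta (x, y)) * cos (theta (x, y))).
  - ring.
  - rewrite <- Hs. ring.
Qed.

(** With [u = Rf + i Sf], these are the equations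
    [u_x = 2 cosh w Sf e^(i theta)] and [u_y = 2 i sinh w Sf e^(i theta)]:
    [theta] is the angle of the image of the horizontal direction, and the
    hyperbolic stretchings along the axes are [2 cosh w] and [2 |sinh w|]. *)
Definition moving_frame (U : C -> Prop) (w theta Rf Sf : C -> R) : Prop :=
  forall x y, U (x, y) ->
    is_derive (fun t : R => Rf (t, y)) x
      (2 * (cosh (w (x, y)) * cos (theta (x, y)) * Sf (x, y))) /\
    is_derive (fun t : R => Rf (x, t)) y
      (- 2 * (sinh (w (x, y)) * sin (theta (x, y)) * Sf (x, y))) /\
    is_derive (fun t : R => Sf (t, y)) x
      (2 * (cosh (w (x, y)) * sin (theta (x, y)) * Sf (x, y))) /\
    is_derive (fun t : R => Sf (x, t)) y
      (2 * (sinh (w (x, y)) * cos (theta (x, y)) * Sf (x, y))).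

(** The frame equations express the first derivatives as products of C1
    functions, which gives the second order of regularity. *)
Lemma moving_frame_C2 (U : C -> Prop) (w theta Rf Sf : C -> R) :
  open U -> C1_on U w -> C1_on U theta -> moving_frame U w theta Rf Sf ->
  (forall z, U z -> continuous Sf z) ->
  (C2_on U Rf /\ C2_on U Sf) /\
  (forall z, U z ->
     dx Rf z = 2 * (cosh (w z) * cos (theta z) * Sf z) /\
     dy Rf z = - 2 * (sinh (w z) * sin (theta z) * Sf z) /\
     dx Sf z = 2 * (cosh (w z) * sin (theta z) * Sf z) /\
     dy Sf z = 2 * (sinh (w z) * cos (theta z) * Sf z)).
Proof.
  intros HO Hw Ht HF HcS.
  assert (Hc : forall z, U z -> continuous w z /\ continuous theta z /\ continuous Sf z).
  { intros z Hz. split; [|split; [|now apply HcS]].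
    - now apply (C1_continuous U w). - now apply (C1_continuous U theta). }
  destruct (C1_intro U Rf (fun z => 2 * (cosh (w z) * cos (theta z) * Sf z))
    (fun z => - 2 * (sinh (w z) * sin (theta z) * Sf z)) HO) as [CR ER].
  { intros x y Hz. now destruct (HF x y Hz) as [? [? _]]. }
  { intros z Hz. destruct (Hc z Hz) as [? [? ?]]. split; solve_continuous. }
  destruct (C1_intro U Sf (fun z => 2 * (cosh (w z) * sin (theta z) * Sf z))
    (fun z => 2 * (sinh (w z) * cos (theta z) * Sf z)) HO) as [CS ES].
  { intros x y Hz. now destruct (HF x y Hz) as [_ [_ [? ?]]]. }
  { intros z Hz. destruct (Hc z Hz) as [? [? ?]]. split; solve_continuous. }
  split; [|intros z Hz; destruct (ER z Hz), (ES z Hz); auto].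
  split; (split; [assumption|split]).
  - apply (C1_ext U _ (fun z => 2 * (cosh (w z) * cos (theta z) * Sf z)) HO);
      [apply ER|]; auto 10 using C1_scal, C1_mult, C1_cosh, C1_sinh, C1_cos, C1_sin.
  - apply (C1_ext U _ (fun z => - 2 * (sinh (w z) * sin (theta z) * Sf z)) HO);
      [apply ER|]; auto 10 using C1_scal, C1_mult, C1_cosh, C1_sinh, C1_cos, C1_sin.
  - apply (C1_ext U _ (fun z => 2 * (cosh (w z) * sin (theta z) * Sf z)) HO);
      [apply ES|]; auto 10 using C1_scal, C1_mult, C1_cosh, C1_sinh, C1_cos, C1_sin.
  - apply (C1_ext U _ (fun z => 2 * (sinh (w z) * cos (theta z) * Sf z)) HO);
      [apply ES|]; auto 10 using C1_scal, C1_mult, C1_cosh, C1_sinh, C1_cos, C1_sin.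
Qed.

Lemma d_z_parts (u : C -> C) z :
  d_z u z = (/ 2 * (dx (fun p => Re (u p)) z + dy (fun p => Im (u p)) z),
             / 2 * (dx (fun p => Im (u p)) z - dy (fun p => Re (u p)) z)).
Proof.
  unfold d_z, cdx, cdy, Ci, RtoC, Cmult, Cminus, Cplus, Copp. cbn [fst snd].
  f_equal; ring.
Qed.

Lemma d_zbar_parts (u : C -> C) z :
  d_zbar u z = (/ 2 * (dx (fun p => Re (u p)) z - dy (fun p => Im (u p)) z),
                / 2 * (dx (fun p => Im (u p)) z + dy (fun p => Re (u p)) z)).
Proof.
  unfold d_zbar, cdx, cdy, Ci, RtoC, Cmult, Cminus, Cplus, Copp. cbn [fst snd].
  f_equal; ring.
Qed.

Lemma dx_eq (U : C -> Prop) f g x y l : open U -> (forall z, U z -> f z = g z) -> U (x, y) ->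
  is_derive (fun t : R => g (t, y)) x l -> dx f (x, y) = l.
Proof. intros. apply is_derive_unique. now apply (is_derive_x_ext U f g). Qed.

Lemma dy_eq (U : C -> Prop) f g x y l : open U -> (forall z, U z -> f z = g z) -> U (x, y) ->
  is_derive (fun t : R => g (x, t)) y l -> dy f (x, y) = l.
Proof. intros. apply is_derive_unique. now apply (is_derive_y_ext U f g). Qed.

(** In complex form the frame equations are [u_z = e^w Sf e^(i theta)] and
    [u_zbar = e^(-w) Sf e^(i theta)]. The Beltrami equation and the
    normalization are read off; after division by [u_zbar], harmonicity is
    [- w_z + Sf_z / Sf + i theta_z + i e^w e^(i theta) = 0], whose real and
    imaginary parts are the two equations of the Baecklund transformation. *)
Lemma frame_corresponding_harmonic (U : C -> Prop) (w theta Rf Sf : C -> R) :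
  pointed_domain U -> C2_on U w -> C2_on U theta -> backlund U w theta ->
  moving_frame U w theta Rf Sf ->
  (forall z, U z -> continuous Sf z /\ Sf z <> 0) ->
  corresponding_harmonic_map U w (fun z => (Rf z, Sf z)).
Proof.
  intros HD Hw Ht HB HF HS. assert (HO := proj1 HD).
  destruct (moving_frame_C2 U w theta Rf Sf HO (proj1 Hw) (proj1 Ht) HF) as [[CR CS] E].
  { intros z Hz. now apply HS. }
  assert (Ezb : forall z, U z -> d_zbar (fun z => (Rf z, Sf z)) z =
     (exp (- w z) * (cos (theta z) * Sf z), exp (- w z) * (sin (theta z) * Sf z))).
  { intros z Hz. rewrite d_zbar_parts. unfold Re, Im. cbn [fst snd].
    change (fun p => Rf p) with Rf. change (fun p => Sf p) with Sf.
    destruct (E z Hz) as [-> [-> [-> ->]]]. rewrite exp_opp_cosh_sinh. f_equal; field. }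
  assert (Ez : forall z, U z -> d_z (fun z => (Rf z, Sf z)) z =
     (exp (w z) * (cos (theta z) * Sf z), exp (w z) * (sin (theta z) * Sf z))).
  { intros z Hz. rewrite d_z_parts. unfold Re, Im. cbn [fst snd].
    change (fun p => Rf p) with Rf. change (fun p => Sf p) with Sf.
    destruct (E z Hz) as [-> [-> [-> ->]]]. rewrite exp_cosh_sinh. f_equal; field. }
  assert (Ezc : forall z, U z -> d_z (fun p => Cconj (Rf p, Sf p)) z =
     (exp (- w z) * (cos (theta z) * Sf z), - (exp (- w z) * (sin (theta z) * Sf z)))).
  { intros z Hz. rewrite d_z_parts. unfold Re, Im, Cconj. cbn [fst snd].
    change (fun p => Rf p) with Rf. unfold dx at 2. unfold dy at 1.
    rewrite !Derive_opp. fold (dx Sf z). fold (dy Sf z).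
    destruct (E z Hz) as [-> [-> [-> ->]]]. rewrite exp_opp_cosh_sinh. f_equal; field. }
  split; [exact HD|]. split; [now apply (backlund_sinh_gordon U w theta)|].
  split; [exact CR|]. split; [exact CS|].
  intros z Hz.
  assert (Ep : 0 < exp (w z)) by apply exp_pos.
  assert (Em : exp (- w z) = / exp (w z)) by apply exp_Ropp.
  assert (Hsc := sin_cos_sq (theta z)).
  destruct (HS z Hz) as [_ S0].
  assert (Hnz : d_z (fun z => (Rf z, Sf z)) z <> RtoC 0).
  { rewrite (Ez z Hz). intros H. injection H as H1 H2.
    assert (Hc : cos (theta z) = 0).
    { apply (Rmult_eq_reg_l (exp (w z) * Sf z)); [rewrite Rmult_0_r, <- H1; ring|nra]. }
    assert (Hs : sin (theta z) = 0).
    { apply (Rmult_eq_reg_l (exp (w z) * Sf z)); [rewrite Rmult_0_r, <- H2; ring|nra]. }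
    rewrite Hc, Hs in Hsc. lra. }
  split; [exact S0|]. split; [exact Hnz|].
  assert (Hratio : d_zbar (fun z => (Rf z, Sf z)) z =
     (RtoC (exp (- 2 * w z)) * d_z (fun z => (Rf z, Sf z)) z)%C).
  { rewrite (Ezb z Hz), (Ez z Hz). replace (- 2 * w z) with (- w z + - w z) by ring.
    rewrite exp_plus, Em. unfold Cmult, RtoC. cbn [fst snd].
    f_equal; field; lra. }
  split; [|split].
  - rewrite Hratio. field. exact Hnz.
  - destruct z as [x y].
    rewrite (d_z_parts (d_zbar _)).
    destruct Hw as [Hw _]. destruct Ht as [Ht _].
    assert (W1 := C1_derive_x U w x y Hw Hz). assert (W2 := C1_derive_y U w x y Hw Hz).
    assert (T1 := C1_derive_x U theta x y Ht Hz). assert (T2 := C1_derive_y U theta x y Ht Hz).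
    destruct (HF x y Hz) as [_ [_ [S1 S2]]].
    erewrite (dx_eq U (fun p => Re (d_zbar (fun z => (Rf z, Sf z)) p))
      (fun z => exp (- w z) * (cos (theta z) * Sf z)) x y);
      [|exact HO|intros p Hp; cbv beta; now rewrite (Ezb p Hp)|exact Hz|differentiate].
    erewrite (dy_eq U (fun p => Im (d_zbar (fun z => (Rf z, Sf z)) p))
      (fun z => exp (- w z) * (sin (theta z) * Sf z)) x y);
      [|exact HO|intros p Hp; cbv beta; now rewrite (Ezb p Hp)|exact Hz|differentiate].
    erewrite (dx_eq U (fun p => Im (d_zbar (fun z => (Rf z, Sf z)) p))
      (fun z => exp (- w z) * (sin (theta z) * Sf z)) x y);
      [|exact HO|intros p Hp; cbv beta; now rewrite (Ezb p Hp)|exact Hz|differentiate].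
    erewrite (dy_eq U (fun p => Re (d_zbar (fun z => (Rf z, Sf z)) p))
      (fun z => exp (- w z) * (cos (theta z) * Sf z)) x y);
      [|exact HO|intros p Hp; cbv beta; now rewrite (Ezb p Hp)|exact Hz|differentiate].
    cbv beta. change (AbsRing.sort R_AbsRing) with R.
    rewrite (Ezb _ Hz), (Ez _ Hz).
    unfold Im. cbn [snd].
    rewrite exp_opp_cosh_sinh, exp_cosh_sinh.
    destruct (HB _ Hz) as [B1 B2].
    replace (dy theta (x, y)) with (dx w (x, y) + 2 * sinh (w (x, y)) * sin (theta (x, y))) by lra.
    replace (dx theta (x, y)) with (- dy w (x, y) - 2 * cosh (w (x, y)) * cos (theta (x, y))) by lra.
    unfold Cdiv, Cinv, Cmult, Cplus, Ci, RtoC. cbn [fst snd].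
    f_equal.
    + field. exact S0.
    + field_simplify; [|exact S0].
      replace (sin (theta (x, y)) ^ 2) with (1 - cos (theta (x, y)) * cos (theta (x, y))) by (rewrite <- Hsc; ring).
      field.
  - rewrite (Ez z Hz), (Ezc z Hz), Em. unfold Im. cbn [snd].
    unfold Cdiv, Cinv, Cmult, RtoC. cbn [fst snd].
    f_equal.
    + field_simplify; [|split; [exact S0|lra]].
      replace (sin (theta z) ^ 2) with (1 - cos (theta z) * cos (theta z)) by (rewrite <- Hsc; ring).
      field. exact S0.
    + field. split; [exact S0|lra].
Qed.

(** * The explicit formulas define a moving frame *)

(** The ordinary differential data on the real axis behind a separated solution:
    [b] is half the logarithmic derivative of the factor in [x], [b'] its
    derivative, [c0] stands for [cosh w] on the axis and [X] for its
    primitive. The equation for the derivative of [b'] is the derivative of the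
    first integral [b' = 2 c0 (1 - b^2) - k]. *)
Definition separated_profile (U : C -> Prop) (w : C -> R) (b b' c0 X : R -> R) : Prop :=
  forall x y, U (x, y) ->
    1 + b x <> 0 /\
    dx w (x, y) = 2 * b x * sinh (w (x, y)) /\
    is_derive b x (b' x) /\
    is_derive b' x (4 * b x * (1 - b x * b x) * (c0 x * c0 x - 1) - 4 * c0 x * b x * b' x) /\
    is_derive c0 x (2 * b x * (c0 x * c0 x - 1)) /\
    is_derive X x (c0 x).

(** The logarithmic derivative of [exp (2 X) / (1 + b)], the factor common to
    [Rf - R0] and [Sf]. *)
Definition scale_rate (b b' c0 : R -> R) (x : R) : R := 2 * c0 x - b' x / (1 + b x).

(** With [K] this logarithmic derivative, [K' = (b' + K b)^2 - 4 b^2]: being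
    polynomial in [b], [b'] and [K], this form keeps the identities of
    [frame_alignment] free of denominators. *)
Lemma is_derive_scale_rate (b b' c0 : R -> R) (x : R) :
  1 + b x <> 0 ->
  is_derive b x (b' x) ->
  is_derive b' x (4 * b x * (1 - b x * b x) * (c0 x * c0 x - 1) - 4 * c0 x * b x * b' x) ->
  is_derive c0 x (2 * b x * (c0 x * c0 x - 1)) ->
  is_derive (scale_rate b b' c0) x
    ((b' x + scale_rate b b' c0 x * b x) * (b' x + scale_rate b b' c0 x * b x) - 4 * (b x * b x)).
Proof.
  intros H0 Hb Hb' Hc. unfold scale_rate.
  compute_derivative; [exact H0|]. field. exact H0.
Qed.

(** Everything but [w_yy] comes from differentiating [w_x = 2 b sinh w], and
    [w_yy] is then given by the sinh-Gordon equation. *)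
Lemma separated_second_derivatives (U : C -> Prop) (w : C -> R) (b b' : R -> R) x y :
  open U -> sinh_gordon U w ->
  (forall x y, U (x, y) -> dx w (x, y) = 2 * b x * sinh (w (x, y))) ->
  U (x, y) -> is_derive b x (b' x) ->
  is_derive (fun t : R => dy w (t, y)) x (2 * b x * cosh (w (x, y)) * dy w (x, y)) /\
  is_derive (fun t : R => dy w (x, t)) y
    (2 * sinh (w (x, y)) * (2 * cosh (w (x, y)) * (1 - b x * b x) - b' x)).
Proof.
  intros HO [Hw HSG] Hwx Hz Hb.
  assert (Hmix := mixed_partials U w (x, y) HO Hw Hz).
  destruct Hw as [Hw [Hwxx Hwyy]].
  assert (W1 := C1_derive_x U w x y Hw Hz). assert (W2 := C1_derive_y U w x y Hw Hz).
  assert (Hwx' : forall z, U z -> dx w z = 2 * b (fst z) * sinh (w z)).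
  { intros [u v]; apply Hwx. }
  assert (Exy : dy (dx w) (x, y) = 2 * b x * cosh (w (x, y)) * dy w (x, y)).
  { apply (dy_eq U _ (fun z => 2 * b (fst z) * sinh (w z))); auto. cbn [fst].
    compute_derivative. ring. }
  assert (Exx : dx (dx w) (x, y) = 2 * b' x * sinh (w (x, y))
             + 2 * b x * cosh (w (x, y)) * dx w (x, y)).
  { apply (dx_eq U _ (fun z => 2 * b (fst z) * sinh (w z))); auto. cbn [fst].
    compute_derivative. ring. }
  split.
  - rewrite <- Exy, <- Hmix. now apply (C1_derive_x U).
  - apply is_derive_value with (dy (dy w) (x, y)); [now apply (C1_derive_y U)|].
    specialize (HSG _ Hz). unfold laplacian in HSG. rewrite sinh_double, Exx, Hwx in HSG by auto.
    lra.
Qed.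

(** The number [M] for which the vector [(K - 2 b cosh w, w_y)] turns out to be
    [M (sin theta, - cos theta)]. *)
Definition alignment_amplitude (b b' c0 : R -> R) (w : C -> R) (z : C) : R :=
  2 * cosh (w z) - (b' (fst z) + scale_rate b b' c0 (fst z) * b (fst z)).

(** This is the compatibility between [theta], known from its two partial
    derivatives, and the profile [b]; rotated by [theta] it says exactly that
    the formulas have the [x]-derivatives of a moving frame. It is
    not a pointwise consequence of the equations. The two left-hand sides
    solve a homogeneous linear system in each of the directions [x] and [y],
    and they vanish at the origin, where [theta = PI / 2] and [w_y = 0]; so
    they vanish on the whole connected domain, whatever its shape. *)
Lemma frame_alignment (U : C -> Prop) (w theta : C -> R) (b b' c0 X : R -> R) :
  pointed_domain U -> C2_on U w -> C2_on U theta -> backlund U w theta ->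
  separated_profile U w b b' c0 X ->
  theta (0, 0) = PI / 2 -> dy w (0, 0) = 0 -> c0 0 = cosh (w (0, 0)) ->
  forall z, U z ->
    scale_rate b b' c0 (fst z) - 2 * b (fst z) * cosh (w z)
      - alignment_amplitude b b' c0 w z * sin (theta z) = 0 /\
    dy w z + alignment_amplitude b b' c0 w z * cos (theta z) = 0.
Proof.
  intros [HO [[HU _] H0]] Hw Ht HB HP Hth0 Hwy0 Hc0 z Hz.
  assert (HSG := backlund_sinh_gordon U w theta HO Hw Ht HB).
  set (K := scale_rate b b' c0). set (M := alignment_amplitude b b' c0 w).
  apply (linear_system_zero U
    (fun z => K (fst z) - 2 * b (fst z) * cosh (w z) - M z * sin (theta z))
    (fun z => dy w z + M z * cos (theta z))
    (fun z => 2 * b (fst z) * cosh (w z) + sin (theta z) * (b' (fst z) + K (fst z) * b (fst z)))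
    (fun z => M z * cos (theta z))
    (fun z => - (cos (theta z) * (b' (fst z) + K (fst z) * b (fst z))))
    (fun z => 2 * b (fst z) * cosh (w z) + M z * sin (theta z))
    (fun _ => 0)
    (fun z => - 2 * sinh (w z) * (b (fst z) + sin (theta z)))
    (fun z => 2 * sinh (w z) * b (fst z))
    (fun z => 2 * sinh (w z) * cos (theta z))) with (0, 0); auto.
  - clear z Hz. intros x y Hz.
    destruct (HP x y Hz) as [Hb1 [Hwx [Hb [Hb' [Hc HX]]]]].
    assert (DK := is_derive_scale_rate b b' c0 x Hb1 Hb Hb' Hc). fold K in DK.
    destruct (separated_second_derivatives U w b b' x y HO HSG) as [Wyx Wyy]; auto.
    { intros u v Huv. apply (HP u v Huv). }
    (* Read as an equation for [b'], the definition of [K] eliminates [b'] without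
       introducing a division. *)
    assert (HKdef : b' x = (2 * c0 x - K x) * (1 + b x)).
    { unfold K, scale_rate. field. exact Hb1. }
    destruct Hw as [Hw _]. destruct Ht as [Ht _].
    assert (W1 := C1_derive_x U w x y Hw Hz). assert (W2 := C1_derive_y U w x y Hw Hz).
    assert (T1 := C1_derive_x U theta x y Ht Hz). assert (T2 := C1_derive_y U theta x y Ht Hz).
    destruct (HB _ Hz) as [B1 B2].
    assert (Et : dy theta (x, y) = 2 * sinh (w (x, y)) * (b x + sin (theta (x, y))))
      by (rewrite Hwx in B1; lra).
    assert (Ex : dx theta (x, y) = - dy w (x, y) - 2 * cosh (w (x, y)) * cos (theta (x, y))) by lra.
    rewrite Hwx in W1. rewrite Et in T2. rewrite Ex in T1.
    clear Et Ex B1 B2 HX HB HP.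
    assert (Hch := cosh_sinh_sq (w (x, y))). assert (Hs := sin_cos_sq (theta (x, y))).
    unfold M, alignment_amplitude. fold K. cbn [fst].
    split; [|split; [|split]]; compute_derivative.
    + rewrite HKdef. ring [Hch Hs].
    + rewrite HKdef. ring [Hch Hs].
    + ring [Hch Hs].
    + ring [Hch Hs].
  - clear z Hz. intros [x y] Hz.
    destruct (HP x y Hz) as [Hb1 [Hwx [Hb [Hb' [Hc HX]]]]].
    assert (DK := is_derive_scale_rate b b' c0 x Hb1 Hb Hb' Hc). fold K in DK.
    assert (Cb := continuous_fst_comp b x y (continuous_of_is_derive _ _ _ Hb)).
    assert (Cb' := continuous_fst_comp b' x y (continuous_of_is_derive _ _ _ Hb')).
    assert (CK := continuous_fst_comp K x y (continuous_of_is_derive _ _ _ DK)).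
    assert (Cw := C1_continuous U w _ HO (proj1 Hw) Hz).
    assert (Ct := C1_continuous U theta _ HO (proj1 Ht) Hz).
    unfold M, alignment_amplitude. fold K.
    split; (split; [|split; [|split]]); solve_continuous.
  - destruct (HP 0 0 H0) as [Hb1 _].
    unfold M, alignment_amplitude, K, scale_rate. cbn [fst]. rewrite Hth0, sin_PI2, Hc0. field. exact Hb1.
  - rewrite Hth0, cos_PI2, Hwy0. ring.
Qed.

(** With [kappa = exp (2 X) / (1 + b)] and [f = sin theta + b] the formulas are
    [Rf = R0 + S0 kappa cos theta] and [Sf = S0 kappa f]. By alignment
    [f_x = (2 cosh w sin theta - K) f] and [f_y = 2 sinh w cos theta f], while
    [kappa' = K kappa]; hence the frame equations. The same two equations show
    that a zero of [f] would spread to the origin, where [f = 1 + b]: so [Sf]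
    vanishes nowhere. *)
Lemma separated_frame (U : C -> Prop) (w theta : C -> R) (b b' c0 X : R -> R)
    (Rf Sf : C -> R) (R0 S0 : R) :
  pointed_domain U -> C2_on U w -> C2_on U theta -> backlund U w theta ->
  separated_profile U w b b' c0 X ->
  theta (0, 0) = PI / 2 -> dy w (0, 0) = 0 -> c0 0 = cosh (w (0, 0)) -> S0 <> 0 ->
  (forall x y, U (x, y) ->
     Sf (x, y) = S0 * (exp (2 * X x) * (sin (theta (x, y)) + b x) / (1 + b x))) ->
  (forall x y, U (x, y) ->
     Rf (x, y) = R0 + S0 * (exp (2 * X x) * cos (theta (x, y)) / (1 + b x))) ->
  corresponding_harmonic_map U w (fun z => (Rf z, Sf z)).
Proof.
  intros HD Hw Ht HB HP Hth0 Hwy0 Hc0 HS0 HSf HRf.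
  assert (HE := frame_alignment U w theta b b' c0 X HD Hw Ht HB HP Hth0 Hwy0 Hc0).
  assert (HO := proj1 HD). assert (HU := proj1 (proj1 (proj2 HD))).
  assert (H0 := proj2 (proj2 HD)).
  set (K := scale_rate b b' c0) in *.
  set (kappa := fun x => exp (2 * X x) / (1 + b x)).
  assert (HSf' : forall z, U z -> Sf z = 0 + S0 * (kappa (fst z) * (sin (theta z) + b (fst z)))).
  { intros [x y] Hz. rewrite HSf by exact Hz. unfold kappa. cbn [fst].
    field. apply (HP x y Hz). }
  assert (HRf' : forall z, U z -> Rf z = R0 + S0 * (kappa (fst z) * cos (theta z))).
  { intros [x y] Hz. rewrite HRf by exact Hz. unfold kappa. cbn [fst].
    field. apply (HP x y Hz). }
  assert (Dk : forall x y, U (x, y) -> is_derive kappa x (K x * kappa x)).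
  { intros x y Hz. destruct (HP x y Hz) as [Hb1 [_ [Hb [_ [_ HX]]]]].
    unfold kappa. compute_derivative; [exact Hb1|].
    unfold K, scale_rate. field. exact Hb1. }
  assert (Df : forall x y, U (x, y) ->
    is_derive (fun t : R => sin (theta (t, y)) + b t) x
      ((2 * cosh (w (x, y)) * sin (theta (x, y)) - K x) * (sin (theta (x, y)) + b x)) /\
    is_derive (fun t : R => sin (theta (x, t)) + b x) y
      (2 * sinh (w (x, y)) * cos (theta (x, y)) * (sin (theta (x, y)) + b x)) /\
    is_derive (fun t : R => cos (theta (t, y))) x
      (2 * cosh (w (x, y)) * cos (theta (x, y)) * (sin (theta (x, y)) + b x)
       - K x * cos (theta (x, y))) /\
    is_derive (fun t : R => cos (theta (x, t))) y
      (- 2 * sinh (w (x, y)) * sin (theta (x, y)) * (sin (theta (x, y)) + b x))).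
  { intros x y Hz. destruct (HP x y Hz) as [Hb1 [Hwx [Hb _]]].
    destruct (HE _ Hz) as [E1 E2]. unfold alignment_amplitude in E1, E2. fold K in E1, E2. cbn [fst] in E1, E2.
    assert (T1 := C1_derive_x U theta x y (proj1 Ht) Hz).
    assert (T2 := C1_derive_y U theta x y (proj1 Ht) Hz).
    destruct (HB _ Hz) as [B1 B2]. assert (Hs := sin_cos_sq (theta (x, y))).
    assert (Et : dy theta (x, y) = 2 * sinh (w (x, y)) * (b x + sin (theta (x, y))))
      by (rewrite Hwx in B1; lra).
    assert (Ex : dx theta (x, y) = - dy w (x, y) - 2 * cosh (w (x, y)) * cos (theta (x, y))) by lra.
    replace (dy w (x, y)) with (- ((2 * cosh (w (x, y)) - (b' x + K x * b x)) * cos (theta (x, y))))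
      in Ex by lra.
    rewrite Et in T2. rewrite Ex in T1.
    assert (EK : K x = 2 * b x * cosh (w (x, y))
       + (2 * cosh (w (x, y)) - (b' x + K x * b x)) * sin (theta (x, y))) by lra.
    (* Naming [N = b' + K b] makes the alignment relations linear in [b'] and
       [K], so that both can be eliminated. *)
    set (N := b' x + K x * b x) in *.
    assert (Eb' : b' x = N - K x * b x) by (unfold N; ring).
    split; [|split; [|split]]; compute_derivative.
    - rewrite Eb', EK. ring [Hs].
    - ring.
    - rewrite EK. ring [Hs].
    - ring. }
  assert (Cont : forall x y, U (x, y) -> continuous w (x, y) /\ continuous theta (x, y) /\
     continuous (fun z : C => b (fst z)) (x, y) /\ continuous (fun z : C => K (fst z)) (x, y) /\
     continuous (fun z : C => kappa (fst z)) (x, y)).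
  { intros x y Hz. destruct (HP x y Hz) as [Hb1 [_ [Hb [Hb' [Hc _]]]]].
    split; [now apply (C1_continuous U w _ HO (proj1 Hw))|].
    split; [now apply (C1_continuous U theta _ HO (proj1 Ht))|].
    split; [|split]; apply continuous_fst_comp.
    - exact (continuous_of_is_derive _ _ _ Hb).
    - exact (continuous_of_is_derive _ _ _ (is_derive_scale_rate b b' c0 x Hb1 Hb Hb' Hc)).
    - exact (continuous_of_is_derive _ _ _ (Dk x y Hz)). }
  assert (Hf : forall z, U z -> sin (theta z) + b (fst z) <> 0).
  { intros z Hz Hz0.
    assert (Horig : sin (theta (0, 0)) + b (fst (0, 0)) = 0).
    2:{ rewrite Hth0, sin_PI2 in Horig. now apply (HP 0 0 H0). }
    apply (zero_propagates U (fun z => sin (theta z) + b (fst z))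
      (fun z => (2 * cosh (w z) * sin (theta z) - K (fst z)) * (sin (theta z) + b (fst z)))
      (fun z => 2 * sinh (w z) * cos (theta z) * (sin (theta z) + b (fst z)))
      (fun z => Rabs (2 * cosh (w z) * sin (theta z) - K (fst z))
                + Rabs (2 * sinh (w z) * cos (theta z)))) with z; auto.
    - clear z Hz Hz0. intros x y Hz. destruct (Df x y Hz) as [D1 [D2 _]]. cbn [fst].
      split; [exact D1|split; [exact D2|]].
      split; rewrite Rabs_mult; apply Rmult_le_compat_r; try apply Rabs_pos.
      + assert (H := Rabs_pos (2 * sinh (w (x, y)) * cos (theta (x, y)))). lra.
      + assert (H := Rabs_pos (2 * cosh (w (x, y)) * sin (theta (x, y)) - K x)). lra.
    - intros [x y] Hxy. destruct (Cont x y Hxy) as [? [? [? [? _]]]]. solve_continuous. }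
  assert (Dprod : forall (a : R) (k f : R -> R) t k' f',
            is_derive k t k' -> is_derive f t f' ->
            is_derive (fun t : R => a + S0 * (k t * f t)) t (S0 * (k' * f t + k t * f'))).
  { intros a k f t k' f' Hk Hf'. compute_derivative. ring. }
  apply (frame_corresponding_harmonic U w theta Rf Sf HD Hw Ht HB).
  - intros x y Hz. destruct (Df x y Hz) as [D1 [D2 [D3 D4]]]. assert (Dkx := Dk x y Hz).
    rewrite HSf' by exact Hz. cbn [fst].
    split; [|split; [|split]].
    + apply (is_derive_x_ext U Rf _ x y _ HO HRf' Hz). cbn [fst].
      eapply is_derive_value; [exact (Dprod R0 kappa _ x _ _ Dkx D3)|cbv beta; ring].
    + apply (is_derive_y_ext U Rf _ x y _ HO HRf' Hz). cbn [fst].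
      eapply is_derive_value;
        [exact (Dprod R0 (fun _ => kappa x) _ y _ _ (is_derive_Rconst _ _) D4)|cbv beta; ring].
    + apply (is_derive_x_ext U Sf _ x y _ HO HSf' Hz). cbn [fst].
      eapply is_derive_value; [exact (Dprod 0 kappa _ x _ _ Dkx D1)|cbv beta; ring].
    + apply (is_derive_y_ext U Sf _ x y _ HO HSf' Hz). cbn [fst].
      eapply is_derive_value;
        [exact (Dprod 0 (fun _ => kappa x) _ y _ _ (is_derive_Rconst _ _) D2)|cbv beta; ring].
  - intros [x y] Hz. split.
    + destruct (Cont x y Hz) as [? [? [? [? ?]]]].
      apply (continuous_ext_loc Sf (fun z => 0 + S0 * (kappa (fst z) * (sin (theta z) + b (fst z))))).
      * apply (filter_imp U); [|now apply HO]. intros p Hp. symmetry. now apply HSf'.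
      * solve_continuous.
    + rewrite HSf' by exact Hz. cbn [fst]. rewrite Rplus_0_l.
      apply Rmult_integral_contrapositive_currified; [exact HS0|].
      apply Rmult_integral_contrapositive_currified; [|exact (Hf _ Hz)].
      unfold kappa. apply Rmult_integral_contrapositive_currified.
      * apply Rgt_not_eq, exp_pos.
      * apply Rinv_neq_0_compat, (HP x y Hz).
Qed.

(** * The profile of a separated solution *)

Lemma exp_2_arctanh (r : R) : -1 < r < 1 -> exp (2 * arctanh r) = (1 + r) / (1 - r).
Proof.
  intros Hr. unfold arctanh. rewrite <- Rmult_assoc, Rinv_r, Rmult_1_l by lra.
  apply exp_ln. apply Rdiv_lt_0_compat; lra.
Qed.

Lemma sinh_2_arctanh (r : R) : -1 < r < 1 -> sinh (2 * arctanh r) = 2 * r / (1 - r * r).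
Proof.
  intros Hr. unfold sinh. rewrite exp_Ropp, exp_2_arctanh by exact Hr.
  field. split; [nra|split; lra].
Qed.

Lemma cosh_2_arctanh (r : R) :
  -1 < r < 1 -> cosh (2 * arctanh r) = (1 + r * r) / (1 - r * r).
Proof.
  intros Hr. unfold cosh. rewrite exp_Ropp, exp_2_arctanh by exact Hr.
  field. split; [nra|split; lra].
Qed.

Lemma is_derive_arctanh (r : R) : -1 < r < 1 -> is_derive arctanh r (/ (1 - r * r)).
Proof.
  intros Hr. unfold arctanh. auto_derive.
  - split; [lra|split; [apply Rdiv_lt_0_compat; lra|auto]].
  - field. split; [nra|split; lra].
Qed.

(** Separation seen on one line parallel to an axis, along which the other
    factor is a constant [c]; it serves both axes. *)
Definition arctanh_factor (W P : R -> R) (c x : R) : Prop :=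
  -1 < P x * c < 1 /\ W x = 2 * arctanh (P x * c).

Lemma arctanh_factor_sinh_neq0 (W P : R -> R) (c x : R) :
  arctanh_factor W P c x -> P x <> 0 -> c <> 0 -> sinh (W x) <> 0.
Proof.
  intros [Hr ->] HP Hc. rewrite sinh_2_arctanh by exact Hr.
  assert (P x * c <> 0) by (apply Rmult_integral_contrapositive_currified; auto).
  apply Rmult_integral_contrapositive_currified; [lra|]. apply Rinv_neq_0_compat. nra.
Qed.

Lemma arctanh_factor_log_derive (W P : R -> R) (c x w' : R) :
  locally x (arctanh_factor W P c) -> is_derive W x w' ->
  ex_derive P x -> P x <> 0 -> w' = 2 * b_of P x * sinh (W x).
Proof.
  intros HL HW HP HP0.
  destruct (locally_singleton _ _ HL) as [Hr Hx].
  assert (Hd : is_derive W x (2 * (Derive P x * c * / (1 - (P x * c) * (P x * c))))).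
  { apply (is_derive_ext_loc (fun t : R => 2 * arctanh (P t * c))).
    - revert HL. apply filter_imp. now intros t [_ Ht].
    - apply Derive_correct in HP. eapply is_derive_value.
      + apply is_derive_Rmult; [apply is_derive_Rconst|].
        apply (is_derive_chain arctanh); [now apply is_derive_arctanh|].
        apply is_derive_Rmult; [exact HP|apply is_derive_Rconst].
      + cbv beta. change (AbsRing.sort R_AbsRing) with R. ring. }
  rewrite <- (is_derive_unique _ _ _ HW), (is_derive_unique _ _ _ Hd), Hx, sinh_2_arctanh by exact Hr.
  unfold b_of. field. split; [nra|exact HP0].
Qed.

(** The factor is recovered from [W] by
    [P c = tanh (W / 2) = sinh W / (1 + cosh W)], hence is as regular as [W]. *)
Lemma arctanh_factor_ex_derive (W P : R -> R) (c x w' : R) :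
  locally x (arctanh_factor W P c) -> is_derive W x w' -> c <> 0 -> ex_derive P x.
Proof.
  intros HL HW Hc.
  assert (Hden : forall t, 0 < 1 + cosh (W t)).
  { intros t. unfold cosh. assert (H1 := exp_pos (W t)). assert (H2 := exp_pos (- W t)). lra. }
  assert (Hex : ex_derive (fun t : R => sinh (W t) / ((1 + cosh (W t)) * c)) x).
  { eexists. differentiate. specialize (Hden x).
    apply Rmult_integral_contrapositive_currified; [lra|exact Hc]. }
  revert Hex. apply ex_derive_ext_loc. revert HL. apply filter_imp.
  intros t [Hr Ht]. change (sinh (W t) / ((1 + cosh (W t)) * c) = P t).
  rewrite Ht, sinh_2_arctanh, cosh_2_arctanh by exact Hr.
  field. repeat split; try exact Hc; nra.
Qed.

(** Where [sinh W] does not vanish, the slope [b] is [W' / (2 sinh W)] and can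
    therefore be differentiated: this is what makes [b] regular when
    the factor is only known to be once differentiable. *)
Lemma is_derive_slope_of_profile (W W' b : R -> R) (x w'' : R) :
  locally x (fun t : R => W' t = 2 * b t * sinh (W t)) ->
  is_derive W x (W' x) -> is_derive W' x w'' -> sinh (W x) <> 0 ->
  is_derive b x (w'' / (2 * sinh (W x)) - 2 * (b x * b x) * cosh (W x)).
Proof.
  intros HL HW HW' Hs.
  assert (Hx := locally_singleton _ _ HL). cbv beta in Hx.
  assert (Hnz : locally x (fun t : R => sinh (W t) <> 0)).
  { assert (Hc : continuous (fun t : R => sinh (W t)) x).
    { eapply continuous_of_is_derive. differentiate. }
    exact (continuous_neq0_locally (fun t : R => sinh (W t)) x Hc Hs). }
  apply (is_derive_ext_loc (fun t : R => W' t / (2 * sinh (W t)))).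
  - generalize (filter_and _ _ HL Hnz). apply filter_imp. intros t [Ht Hst].
    change (W' t / (2 * sinh (W t)) = b t). rewrite Ht. field. exact Hst.
  - compute_derivative; [lra|]. rewrite Hx. field. exact Hs.
Qed.

Lemma separated_in_x (D : C -> Prop) w F G x y :
  open D -> separated D w F G -> D (x, y) ->
  locally x (arctanh_factor (fun t : R => w (t, y)) F (G y)).
Proof.
  intros HO HS Hz. generalize (open_in_x D x y HO Hz). apply filter_imp.
  intros t Ht. now apply HS.
Qed.

Lemma separated_in_y (D : C -> Prop) w F G x y :
  open D -> separated D w F G -> D (x, y) ->
  locally y (arctanh_factor (fun t : R => w (x, t)) G (F x)).
Proof.
  intros HO HS Hz. generalize (open_in_y D x y HO Hz). apply filter_imp.
  intros t Ht. unfold arctanh_factor. rewrite Rmult_comm. now apply HS.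
Qed.

Lemma log_slope_in_x (D : C -> Prop) w F G x y :
  open D -> C1_on D w -> separated D w F G -> D (x, y) ->
  ex_derive F x -> F x <> 0 -> dx w (x, y) = 2 * b_of F x * sinh (w (x, y)).
Proof.
  intros HO Hw HS Hz HF HF0.
  apply (arctanh_factor_log_derive (fun t => w (t, y)) F (G y) x); auto.
  - now apply (separated_in_x D).
  - now apply (C1_derive_x D).
Qed.

Lemma log_slope_in_y (D : C -> Prop) w F G x y :
  open D -> C1_on D w -> separated D w F G -> D (x, y) ->
  ex_derive G y -> G y <> 0 -> dy w (x, y) = 2 * b_of G y * sinh (w (x, y)).
Proof.
  intros HO Hw HS Hz HG HG0.
  apply (arctanh_factor_log_derive (fun t => w (x, t)) G (F x) y); auto.
  - now apply (separated_in_y D).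
  - now apply (C1_derive_y D).
Qed.

(** On vertical lines [w_y = 2 a(y) sinh w], where [a] is half the logarithmic
    derivative of [G], and [a 0 = 0] since [w_y] vanishes at the origin.
    Differentiating at [y = 0] gives the statement with [k = a' 0], the same for
    all abscissas. *)
Lemma axis_curvature (D : C -> Prop) w F G :
  open D -> C2_on D w -> separated D w F G -> D (0, 0) ->
  dy w (0, 0) = 0 -> F 0 <> 0 -> G 0 <> 0 ->
  exists k, forall x, D (x, 0) -> dy (dy w) (x, 0) = 2 * k * sinh (w (x, 0)).
Proof.
  intros HO [Hw [_ Hwy]] HS H0 Hwy0 HF0 HG0.
  assert (HexG : locally 0 (fun y : R => ex_derive G y)).
  { generalize (open_in_y D 0 0 HO H0). apply filter_imp. intros y Hy.
    apply (arctanh_factor_ex_derive (fun t => w (0, t)) G (F 0) y (dy w (0, y))); auto.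
    - now apply (separated_in_y D).
    - now apply (C1_derive_y D). }
  assert (HnzG : locally 0 (fun y : R => G y <> 0)).
  { assert (Hc : continuous G 0).
    { apply (ex_derive_continuous G). exact (locally_singleton _ _ HexG). }
    exact (continuous_neq0_locally G 0 Hc HG0). }
  assert (Hslope : forall x, D (x, 0) ->
     locally 0 (fun y : R => dy w (x, y) = 2 * b_of G y * sinh (w (x, y)))).
  { intros x Hx. generalize (filter_and _ _ (open_in_y D x 0 HO Hx) (filter_and _ _ HexG HnzG)).
    apply filter_imp. intros y [Hy [Hy1 Hy2]]. now apply (log_slope_in_y D w F G). }
  assert (Hs0 : sinh (w (0, 0)) <> 0).
  { apply (arctanh_factor_sinh_neq0 (fun t => w (t, 0)) F (G 0) 0); auto.
    now apply HS. }
  assert (Ha0 : b_of G 0 = 0).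
  { assert (H := locally_singleton _ _ (Hslope 0 H0)). cbv beta in H. rewrite Hwy0 in H.
    apply (Rmult_eq_reg_r (2 * sinh (w (0, 0)))); [lra|lra]. }
  assert (Da := is_derive_slope_of_profile (fun y => w (0, y)) (fun y => dy w (0, y)) (b_of G) 0
     (dy (dy w) (0, 0)) (Hslope 0 H0) (C1_derive_y D w 0 0 Hw H0)
     (C1_derive_y D (dy w) 0 0 Hwy H0) Hs0).
  cbv beta in Da. revert Da.
  generalize (dy (dy w) (0, 0) / (2 * sinh (w (0, 0)))
              - 2 * (b_of G 0 * b_of G 0) * cosh (w (0, 0))).
  intros k Da. exists k. intros x Hx.
  assert (W2 := C1_derive_y D w x 0 Hw Hx).
  change (Derive (fun y : R => dy w (x, y)) 0 = 2 * k * sinh (w (x, 0))).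
  apply is_derive_unique.
  apply (is_derive_ext_loc (fun y : R => 2 * b_of G y * sinh (w (x, y)))).
  { generalize (Hslope x Hx). apply filter_imp. intros y Hy. symmetry. exact Hy. }
  compute_derivative. rewrite Ha0. ring.
Qed.

Lemma is_derive_X_of (w : C -> R) (x : R) :
  locally x (fun r : R => forall t, Rmin 0 r <= t <= Rmax 0 r ->
                 continuous (fun t : R => w (t, 0)) t) ->
  is_derive (X_of w) x (cosh (w (x, 0))).
Proof.
  intros HL.
  assert (Hcont : forall t, continuous (fun t : R => w (t, 0)) t ->
            continuous (fun t : R => cosh (w (t, 0))) t).
  { intros t Ht. apply (continuous_comp (fun t : R => w (t, 0)) cosh); [exact Ht|].
    exact (continuous_of_is_derive _ _ _ (is_derive_cosh _)). }
  apply (is_derive_RInt (fun t : R => cosh (w (t, 0))) (X_of w) 0 x).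
  - revert HL. apply filter_imp. intros r Hr.
    apply (RInt_correct (V := R_CompleteNormedModule)).
    apply ex_RInt_continuous. intros t Ht. apply Hcont, (Hr t Ht).
  - apply Hcont. apply (locally_singleton _ _ HL). split; [apply Rmin_r|apply Rmax_r].
Qed.

(** Unique continuation for separated solutions. Let [w] and [w_y] vanish at
    [(x0, y0)], and suppose [G y1 <> 0] for some nearby [y1]. Then [b_of F] is
    differentiable at [x0], as seen on the line [y = y1], so on the
    vertical line through [(x0, y0)] the pair [(sinh w, w_y)] solves a linear
    homogeneous system with zero initial value; it vanishes up to [y1], which
    contradicts [G y1 <> 0]. Hence [G] vanishes near [y0] and [w] near
    [(x0, y0)]: the set of such points is both open and closed. *)
Lemma separated_flat (U : C -> Prop) (w : C -> R) (F G : R -> R) :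
  open U -> path_connected U -> sinh_gordon U w -> separated U w F G ->
  (forall x y, U (x, y) -> ex_derive F x /\ F x <> 0) ->
  forall p q, U p -> U q -> w p = 0 /\ dy w p = 0 -> w q = 0 /\ dy w q = 0.
Proof.
  intros HO HU HSG HS HF. assert (Hw := proj1 HSG).
  apply (locally_decided_constant U (fun z => w z = 0 /\ dy w z = 0)); [exact HU|].
  intros [x0 y0] Hz.
  assert (Cw := C1_continuous U w _ HO (proj1 Hw) Hz).
  destruct (classic (w (x0, y0) = 0 /\ dy w (x0, y0) = 0)) as [[Hw0 Hwy0]|Hn].
  2:{ right. destruct (Req_dec (w (x0, y0)) 0) as [Hw0|Hw0].
      - assert (Hwy0 : dy w (x0, y0) <> 0) by tauto.
        assert (Cwy := proj2 (proj2 (proj2 (proj1 Hw _ Hz)))).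
        generalize (continuous_neq0_locally (dy w) _ Cwy Hwy0). apply filter_imp. tauto.
      - generalize (continuous_neq0_locally w _ Cw Hw0). apply filter_imp. tauto. }
  left.
  assert (Cch : continuous (fun z => cosh (w z)) (x0, y0)) by solve_continuous.
  assert (Hloc := filter_and _ _ (HO _ Hz) (continuous_locally_bounded _ _ Cch)).
  apply locally_box in Hloc. destruct Hloc as [d Hd].
  set (B := Rabs (cosh (w (x0, y0))) + 1) in Hd.
  assert (Hx0 : Rabs (x0 - x0) < d) by (rewrite Rminus_eq_0, Rabs_R0; apply cond_pos).
  assert (Hy0 : Rabs (y0 - y0) < d) by (rewrite Rminus_eq_0, Rabs_R0; apply cond_pos).
  assert (Hslope : forall x y, U (x, y) -> dx w (x, y) = 2 * b_of F x * sinh (w (x, y))).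
  { intros x y Hxy. destruct (HF x y Hxy). apply (log_slope_in_x U w F G); auto. apply Hw. }
  assert (HG : forall y1, Rabs (y1 - y0) < d -> G y1 = 0).
  { intros y1 Hy1. apply NNPP. intros HG1.
    assert (Hz1 := proj1 (Hd x0 y1 Hx0 Hy1)).
    assert (Hs1 : sinh (w (x0, y1)) <> 0).
    { apply (arctanh_factor_sinh_neq0 (fun t => w (t, y1)) F (G y1) x0); auto.
      - now apply HS.
      - apply (HF _ _ Hz1). }
    assert (Db : exists beta, is_derive (b_of F) x0 beta).
    { eexists. apply (is_derive_slope_of_profile (fun t => w (t, y1)) (fun t => dx w (t, y1)) (b_of F) x0
        (dx (dx w) (x0, y1))); auto.
      - generalize (open_in_x U x0 y1 HO Hz1). apply filter_imp. intros t Ht. now apply Hslope.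
      - apply (C1_derive_x U); auto. apply Hw.
      - apply (C1_derive_x U); auto. apply Hw. }
    destruct Db as [beta Db].
    set (q := b_of F x0) in *.
    set (h := fun y => sinh (w (x0, y)) * sinh (w (x0, y)) + dy w (x0, y) * dy w (x0, y)).
    assert (Hh1 : h y1 = 0).
    { apply (gronwall_zero h
        (fun y => 2 * (sinh (w (x0, y)) * dy w (x0, y)) *
           (cosh (w (x0, y)) + 2 * (2 * cosh (w (x0, y)) * (1 - q * q) - beta)))
        (B + 4 * B * Rabs (1 - q * q) + 2 * Rabs beta) y0 y1).
      - intros y Hy. assert (Hy' := between_close y0 d y0 y1 y Hy0 Hy1 Hy).
        assert (Hxy := proj1 (Hd x0 y Hx0 Hy')).
        destruct (separated_second_derivatives U w (b_of F) (fun _ => beta) x0 y HO HSG Hslope Hxy Db)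
          as [_ Wyy]. fold q in Wyy.
        assert (W2 := C1_derive_y U w x0 y (proj1 Hw) Hxy).
        unfold h. compute_derivative. ring.
      - intros y Hy. assert (Hy' := between_close y0 d y0 y1 y Hy0 Hy1 Hy).
        destruct (Hd x0 y Hx0 Hy') as [Hxy HB].
        unfold h. generalize (sinh (w (x0, y))), (dy w (x0, y)). intros s v.
        revert HB. generalize (cosh (w (x0, y))). intros ch HB.
        rewrite (Rabs_right (s * s + v * v)) by nra.
        rewrite Rabs_mult, Rmult_comm. apply Rmult_le_compat; try apply Rabs_pos.
        + eapply Rle_trans; [apply Rabs_triang|].
          rewrite Rabs_mult, (Rabs_right 2) by lra.
          assert (T := Rabs_triang (2 * ch * (1 - q * q)) (- beta)).
          rewrite Rabs_Ropp, !Rabs_mult, (Rabs_right 2) in T by lra.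
          assert (T2 := Rmult_le_compat_r _ _ _ (Rabs_pos (1 - q * q)) (Rlt_le _ _ HB)).
          unfold Rminus at 1. lra.
        + assert (Hp := Rle_0_sqr (s + v)). assert (Hm := Rle_0_sqr (s - v)).
          unfold Rsqr in Hp, Hm. apply Rabs_le. lra.
      - unfold h. rewrite Hw0, Hwy0, sinh_0. ring. }
    unfold h in Hh1. apply Hs1, Rsqr_0_uniq. unfold Rsqr.
    assert (0 <= dy w (x0, y1) * dy w (x0, y1)) by nra.
    assert (0 <= sinh (w (x0, y1)) * sinh (w (x0, y1))) by nra. lra. }
  assert (Hzero : forall u v, Rabs (u - x0) < d -> Rabs (v - y0) < d -> w (u, v) = 0).
  { intros u v Hu Hv. destruct (HS u v (proj1 (Hd u v Hu Hv))) as [_ ->].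
    rewrite (HG v Hv), Rmult_0_r. unfold arctanh.
    replace ((1 + 0) / (1 - 0)) with 1 by field. rewrite ln_1. ring. }
  apply locally_box. exists d. intros u v Hu Hv. split; [now apply Hzero|].
  apply is_derive_unique. apply (is_derive_ext_loc (fun _ : R => 0)); [|apply is_derive_Rconst].
  assert (Hpos : 0 < d - Rabs (v - y0)) by lra.
  exists (mkposreal _ Hpos). intros t Ht. change (Rabs (t - v) < d - Rabs (v - y0)) in Ht.
  symmetry. apply Hzero; [exact Hu|]. cbn [fst].
  replace (t - y0) with ((t - v) + (v - y0)) by ring.
  eapply Rle_lt_trans; [apply Rabs_triang|]. lra.
Qed.

(** When [w] vanishes identically, the transformation reduces to
    [theta_x = - 2 cos theta] and [theta_y = 0], so that [cos theta], which is 0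
    at the origin, satisfies a linear equation in both directions. *)
Lemma backlund_flat (U : C -> Prop) (w theta : C -> R) :
  pointed_domain U -> C1_on U w -> C1_on U theta -> backlund U w theta ->
  theta (0, 0) = PI / 2 ->
  (forall z, U z -> w z = 0 /\ dx w z = 0 /\ dy w z = 0) ->
  forall z, U z -> cos (theta z) = 0 /\ sin (theta z) = 1.
Proof.
  intros [HO [[HU _] H0]] Hw Ht HB Hth0 Hflat.
  assert (T : forall x y, U (x, y) ->
     is_derive (fun t : R => theta (t, y)) x (- 2 * cos (theta (x, y))) /\
     is_derive (fun t : R => theta (x, t)) y 0).
  { intros x y Hz. destruct (HB _ Hz) as [B1 B2]. destruct (Hflat _ Hz) as [E1 [E2 E3]].
    rewrite E1, E2, sinh_0 in B1. rewrite E1, E3, cosh_0 in B2.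
    split; (eapply is_derive_value; [now apply (C1_derive_x U) || now apply (C1_derive_y U)|lra]). }
  assert (Hcos : forall z, U z -> cos (theta z) = 0).
  { intros z Hz.
    apply (zero_propagates U (fun z => cos (theta z))
      (fun z => 2 * sin (theta z) * cos (theta z)) (fun _ => 0) (fun _ => 2)) with (0, 0); auto.
    - clear z Hz. intros x y Hz. destruct (T x y Hz) as [T1 T2].
      split; [compute_derivative; ring|]. split; [compute_derivative; ring|].
      split.
      + rewrite !Rabs_mult, (Rabs_right 2) by lra.
        assert (Hs : Rabs (sin (theta (x, y))) <= 1) by (apply Rabs_le, SIN_bound).
        assert (Hc := Rabs_pos (cos (theta (x, y)))). nra.
      + rewrite Rabs_R0. assert (Hc := Rabs_pos (cos (theta (x, y)))). lra.
    - intros p _. apply continuous_const.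
    - rewrite Hth0. apply cos_PI2. }
  intros z Hz. split; [now apply Hcos|].
  assert (Hs : sin (theta z) - 1 = 0); [|lra].
  apply (zero_propagates U (fun z => sin (theta z) - 1) (fun _ => 0) (fun _ => 0) (fun _ => 0))
    with (0, 0); auto.
  - clear z Hz. intros x y Hz. destruct (T x y Hz) as [T1 T2].
    split; [compute_derivative; rewrite (Hcos _ Hz); ring|].
    split; [compute_derivative; ring|].
    rewrite Rabs_R0. lra.
  - intros p _. apply continuous_const.
  - rewrite Hth0, sin_PI2. ring.
Qed.

(** * The harmonic map given by the explicit formulas *)

Theorem theorem5 :
  forall (D : C -> Prop) (w theta : C -> R) (F G : R -> R)
         (Om : C -> Prop) (Rf Sf : C -> R) (R0 S0 : R),
    BT0 D w theta ->
    separated D w F G ->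
    nonconstant_in_x D F ->
    nonconstant_in_y D G ->
    pointed_domain Om ->
    (forall z : C, Om z -> D z) ->
    formulas_make_sense D Om F ->
    R0 = Rf (0, 0) ->
    S0 = Sf (0, 0) ->
    S0 <> 0 ->
    (forall x y : R, Om (x, y) ->
       Sf (x, y) = S0 * (exp (2 * X_of w x) * (sin (theta (x, y)) + b_of F x)
                         / (1 + b_of F x))) ->
    (forall x y : R, Om (x, y) ->
       Rf (x, y) = R0 + S0 * (exp (2 * X_of w x) * cos (theta (x, y))
                              / (1 + b_of F x))) ->
    corresponding_harmonic_map Om w (fun z : C => (Rf z, Sf z)).
Proof.
  intros D w theta F G Om Rf Sf R0 S0 [[[HOD [_ HD0]] [HwD [HtD HBD]]] [Haxis Hth0]]
    HS _ _ HOm HOmD HF _ _ HS0 HSf HRf.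
  assert (HO := proj1 HOm). assert (HU := proj1 (proj1 (proj2 HOm))).
  assert (H0 := proj2 (proj2 HOm)).
  assert (Hw : C2_on Om w).
  { split; [|split]; intros z Hz; now apply HwD, HOmD. }
  assert (Ht : C2_on Om theta).
  { split; [|split]; intros z Hz; now apply HtD, HOmD. }
  assert (HB : backlund Om w theta) by (intros z Hz; now apply HBD, HOmD).
  assert (HSGD := backlund_sinh_gordon D w theta HOD HwD HtD HBD).
  assert (HSG := backlund_sinh_gordon Om w theta HO Hw Ht HB).
  assert (HxD : forall x y, Om (x, y) -> D (x, 0)).
  { intros x y Hz. destruct (HF x y Hz) as [Hseg _]. apply Hseg. split; [apply Rmin_r|apply Rmax_r]. }
  assert (HX : forall x y, Om (x, y) -> is_derive (X_of w) x (cosh (w (x, 0)))).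
  { intros x y Hz. apply is_derive_X_of. generalize (open_in_x Om x y HO Hz). apply filter_imp.
    intros r Hr t Ht'. destruct (HF r y Hr) as [Hseg _].
    exact (continuous_of_is_derive _ _ _ (C1_derive_x D w t 0 (proj1 HwD) (Hseg t Ht'))). }
  assert (Hslope : forall x y, Om (x, y) ->
     dx w (x, y) = 2 * b_of F x * sinh (w (x, y)) /\
     dx w (x, 0) = 2 * b_of F x * sinh (w (x, 0))).
  { intros x y Hz. destruct (HF x y Hz) as [_ [HF1 [HF2 _]]].
    split; apply (log_slope_in_x D w F G); auto; [apply HwD|apply HwD|now apply (HxD x y)]. }
  destruct (HF 0 0 H0) as [_ [_ [HF0 _]]].
  destruct (Req_dec (G 0) 0) as [HG0|HG0].
  - (* Here [w = 0], [cos theta = 0] and [sin theta = 1] on [Om], so [Rf] and [Sf]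
       do not depend on [b]; it is replaced by 0, because [b_of F] need not be
       differentiable. *)
    assert (Hw0 : forall x, D (x, 0) -> w (x, 0) = 0).
    { intros x Hx. destruct (HS x 0 Hx) as [_ ->]. rewrite HG0, Rmult_0_r. unfold arctanh.
      replace ((1 + 0) / (1 - 0)) with 1 by field. rewrite ln_1. ring. }
    assert (Hflat : forall z, Om z -> w z = 0 /\ dx w z = 0 /\ dy w z = 0).
    { intros [x y] Hz.
      destruct (separated_flat Om w F G HO HU HSG) with (p := (0, 0)) (q := (x, y)) as [E1 E2]; auto.
      - intros u v Huv. now apply HS, HOmD.
      - intros u v Huv. destruct (HF u v Huv) as [_ [? [? _]]]. now split.
      - split; [exact E1|split; [|exact E2]].
        rewrite (proj1 (Hslope x y Hz)), E1, sinh_0. ring. }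
    assert (Hth := backlund_flat Om w theta HOm (proj1 Hw) (proj1 Ht) HB Hth0 Hflat).
    apply (separated_frame Om w theta (fun _ => 0) (fun _ => 0) (fun x => cosh (w (x, 0)))
             (X_of w) Rf Sf R0 S0); auto.
    + intros x y Hz. split; [lra|]. split; [rewrite (proj1 (proj2 (Hflat _ Hz))); ring|].
      split; [apply is_derive_Rconst|].
      split; [eapply is_derive_value; [apply is_derive_Rconst|ring]|].
      split; [|now apply (HX x y)].
      assert (W1 := C1_derive_x D w x 0 (proj1 HwD) (HxD x y Hz)).
      compute_derivative. rewrite Hw0, sinh_0 by now apply (HxD x y). ring.
    + intros x y Hz. rewrite HSf by exact Hz. rewrite (proj2 (Hth _ Hz)).
      field. apply (HF x y Hz).
    + intros x y Hz. rewrite HRf by exact Hz. rewrite (proj1 (Hth _ Hz)).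
      field. apply (HF x y Hz).
  - (* The sinh-Gordon equation on the axis, divided by [2 sinh w], is the first
       integral [b' = 2 cosh w (1 - b^2) - k]. *)
    destruct (axis_curvature D w F G) as [k Hk]; auto.
    apply (separated_frame Om w theta (b_of F)
             (fun x => 2 * cosh (w (x, 0)) * (1 - b_of F x * b_of F x) - k)
             (fun x => cosh (w (x, 0))) (X_of w) Rf Sf R0 S0); auto.
    intros x y Hz. destruct (HF x y Hz) as [_ [HF1 [HF2 HF3]]].
    assert (Hx := HxD x y Hz). destruct (Hslope x y Hz) as [E1 E0].
    assert (W1 := C1_derive_x D w x 0 (proj1 HwD) Hx).
    assert (Hs : sinh (w (x, 0)) <> 0).
    { apply (arctanh_factor_sinh_neq0 (fun t => w (t, 0)) F (G 0) x); auto. now apply HS. }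
    assert (Hch := cosh_sinh_sq (w (x, 0))).
    assert (Db : is_derive (b_of F) x (2 * cosh (w (x, 0)) * (1 - b_of F x * b_of F x) - k)).
    { eapply is_derive_value.
      - apply (is_derive_slope_of_profile (fun t => w (t, 0)) (fun t => dx w (t, 0)) (b_of F) x
                 (dx (dx w) (x, 0))); auto.
        + generalize (open_in_x Om x y HO Hz). apply filter_imp. intros t Ht'. now apply (Hslope t y).
        + apply (C1_derive_x D); [apply HwD|exact Hx].
      - cbv beta. assert (HL := proj2 HSGD _ Hx). unfold laplacian in HL.
        rewrite (Hk x Hx), sinh_double in HL.
        replace (dx (dx w) (x, 0)) with
          (2 * (2 * sinh (w (x, 0)) * cosh (w (x, 0))) - 2 * k * sinh (w (x, 0))) by lra.
        field. exact Hs. }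
    rewrite E0 in W1.
    assert (Dc : is_derive (fun x => cosh (w (x, 0))) x
              (2 * b_of F x * (cosh (w (x, 0)) * cosh (w (x, 0)) - 1))).
    { compute_derivative. ring [Hch]. }
    split; [exact HF3|]. split; [exact E1|]. split; [exact Db|]. split; [|split; [exact Dc|]].
    + compute_derivative. ring [Hch].
    + now apply (HX x y).
Qed.
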